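(* Let $d\ge2$ and $r>d$. If $v\in\mathcal C_r(\mathbb R^d)$, then $K(v)\in\mathcal C_{r+1}(\mathbb R^d)$ and $|K(v)|_{r+1}\le C_r|v|_r^3$, where $C_r$ is a constant independent of $v$.
   Context: $\mathcal C_r(\mathbb R^d)$: continuous complex functions with finite norm $|f|_r=\sup_s|f(s)|\langle s\rangle^r$, $\langle s\rangle=(1+|s|^2)^{1/2}$. $\Sigma_*=\{z=(x,y)\in\mathbb R^d\times\mathbb R^d:x\cdot y=0, z\ne0\}$ with measure $\mu^\Sigma(dz)=|z|^{-1}dz|_{\Sigma_*}$, $dz|_{\Sigma_*}$ the Euclidean induced hypersurface volume. For $v:\mathbb R^d\to\mathbb C$ and $s\in\mathbb R^d$ the wave kinetic integral is $$K(v)(s)=2\pi\int_{\Sigma_*}\big(v_1v_2v_3+v_1v_2v_4-v_1v_3v_4-v_2v_3v_4\big)\mu^\Sigma(dz),$$ where $v_1=v(x+s)$, $v_2=v(y+s)$, $v_3=v(x+y+s)$, $v_4=v(s)$. *)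

(* Defs.v *)
From mathcomp Require Import all_boot all_order all_algebra.
From mathcomp Require Import all_classical all_reals all_analysis.
From mathcomp Require Import complex.

Set Implicit Arguments.
Unset Strict Implicit.
Unset Printing Implicit Defensive.

Import Order.TTheory GRing.Theory Num.Theory.
Local Open Scope classical_set_scope.
Local Open Scope ring_scope.

Section WaveKinetic.
Variable R : realType.
Variable d : nat.

Notation Rd := 'rV[R]_d.
Notation Rdd := (Rd * Rd)%type.

Definition edot (x y : Rd) : R := \sum_(i < d) x ord0 i * y ord0 i.
Definition enorm (x : Rd) : R := Num.sqrt (edot x x).

Definition enorm2 (z : Rdd) : R := Num.sqrt (edot z.1 z.1 + edot z.2 z.2).
Definition edist2 (z w : Rdd) : R := enorm2 (z.1 - w.1, z.2 - w.2).

Definition normc (z : R[i]) : R :=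
  Num.sqrt (complex.Re z ^+ 2 + complex.Im z ^+ 2).

Definition jbr (s : Rd) : R := Num.sqrt (1 + enorm s ^+ 2).

Definition ccontinuous (f : Rd -> R[i]) : Prop :=
  forall s (e : R), 0 < e -> exists2 del : R, 0 < del &
    forall t, enorm (t - s) < del -> normc (f t - f s) < e.

Definition wnorm (r : R) (f : Rd -> R[i]) : R :=
  sup [set normc (f s) * powR (jbr s) r | s in [set: Rd]].

Definition in_Cr (r : R) (f : Rd -> R[i]) : Prop :=
  ccontinuous f /\ exists M : R, forall s, normc (f s) * powR (jbr s) r <= M.

(* volume of the unit ball of R^(2d-1): pi^(d-1) 4^d d! / (2d)! *)
Definition omega_2dm1 : R :=
  pi ^+ d.-1 * 4%:R ^+ d * (d`!)%:R / ((2 * d)`!)%:R.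

(* diameter of a (bounded) set; 0 for the empty set *)
Definition diam (C : set Rdd) : R :=
  sup [set edist2 z w | z in C & w in C].

Definition haus_delta (del : R) (A : set Rdd) : \bar R :=
  ereal_inf [set (\sum_(0 <= j <oo) ((omega_2dm1 * (diam (C j) / 2) ^+ (2 * d).-1)%:E))%E
            | C in [set C : nat -> set Rdd |
                     A `<=` \bigcup_j C j /\
                     forall j z w, C j z -> C j w -> edist2 z w <= del]].

Definition hausdorff (A : set Rdd) : \bar R :=
  ereal_sup [set haus_delta del A | del in [set del : R | 0 < del]].

Definition Sigma_star : set Rdd :=
  [set z | edot z.1 z.2 = 0 /\ z <> (0, 0)].

(* integral of a nonnegative g against the induced surface measure
   dz|_{Sigma_star} (= H^(2d-1) restricted to Sigma_star), by the layer-cake formula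
   int g dmu = int_0^oo mu(g > t) dt *)
Definition surf_int_nonneg (g : Rdd -> R) : \bar R :=
  (\int[@lebesgue_measure R]_(t in `]0%R, +oo[)
      hausdorff (Sigma_star `&` [set z | (t < g z)%R]))%E.

Definition muS_int_nonneg (g : Rdd -> R) : \bar R :=
  surf_int_nonneg (fun z => g z / enorm2 z).

Definition posp (a : R) : R := Num.max a 0.
Definition negp (a : R) : R := Num.max (- a) 0.

Definition muS_integrable (F : Rdd -> R[i]) : Prop :=
  (muS_int_nonneg (fun z => normc (F z)) < +oo)%E.

Definition muS_int (F : Rdd -> R[i]) : R[i] :=
  Complex
    (fine (muS_int_nonneg (fun z => posp (complex.Re (F z))))
     - fine (muS_int_nonneg (fun z => negp (complex.Re (F z)))))
    (fine (muS_int_nonneg (fun z => posp (complex.Im (F z))))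
     - fine (muS_int_nonneg (fun z => negp (complex.Im (F z))))).

Definition K_integrand (v : Rd -> R[i]) (s : Rd) (z : Rdd) : R[i] :=
  let x := z.1 in let y := z.2 in
  let v1 := v (x + s) in let v2 := v (y + s) in
  let v3 := v (x + y + s) in let v4 := v s in
  v1 * v2 * v3 + v1 * v2 * v4 - v1 * v3 * v4 - v2 * v3 * v4.

Definition K (v : Rd -> R[i]) (s : Rd) : R[i] :=
  ((2 * pi)%:C * muS_int (K_integrand v s))%C.

End WaveKinetic.

(* Main.v *)
(** On the quadratic cone [x.y = 0] every coordinate is a Lipschitz function of
    the others where its partner ([x_i] for [y_i]) dominates, so a cube of side [rho]
    carries surface measure [O(rho^(2d-1))], uniformly in its position.  As
    [r > d], the sum over all unit cubes of a product of two weights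
    [<.>^-r] in independent affine combinations of [x] and [y] converges; hence
    the integrals use nothing about the cone but this cube bound.  Orthogonality
    enters once more through [|x+s|^2 + |y+s|^2 = |x+y+s|^2 + |s|^2], which lets
    one extract the factor [<s>^-r] from [v1 v2 v3].  The remaining [<s>^-1]
    comes from [1/|z|], because [<s>] is controlled by [<x>] and [<x+s>].
    Continuity follows from the same bound with an exponent [d < r' < r], since
    [v] is uniformly continuous relative to the weight [<.>^-r'].
    The surface integrals are layer-cake integrals of an outer measure, so only
    monotonicity and countable subadditivity are used, never measurability. *)

Require Import Defs.
From HB Require Import structures.
From mathcomp Require Import all_boot all_order all_algebra.
From mathcomp Require Import all_classical all_reals all_analysis.
From mathcomp Require Import measurable_realfun complex ring lra.
Import Order.TTheory GRing.Theory Num.Theory.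
Import numFieldNormedType.Exports.

Set Implicit Arguments.
Unset Strict Implicit.
Unset Printing Implicit Defensive.

Local Open Scope classical_set_scope.
Local Open Scope ring_scope.

(** * Hausdorff outer measures *)

Section Hausdorff.
Variables (R : realType) (d : nat).
Notation Rdd := ('rV[R]_d * 'rV[R]_d)%type.
Implicit Types (A : set Rdd) (z w : Rdd).

Lemma omega_2dm1_ge0 : 0 <= omega_2dm1 R d.
Proof. by rewrite /omega_2dm1 divr_ge0// !mulr_ge0// exprn_ge0// pi_ge0. Qed.

Lemma diam_ge0 A : 0 <= diam A.
Proof.
rewrite /diam; set E := [set _ | _ in _ & _ in _].
have [[[x Ex] ubE]|/sup_out->//] := pselect (has_sup E).
apply: le_trans (ub_le_sup ubE Ex).
by case: Ex => z _ [w _ <-]; exact: sqrtr_ge0.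
Qed.

(* Giving infinite weight to sets of large diameter turns the mesh condition of
   [haus_delta] into a weight, and every set belongs to the sigma-algebra
   generated by all sets; so [haus_delta] is an instance of [mu_ext]. *)
Let Tdd := g_sigma_algebraType (@setT (set Rdd)).

Let hweight (del : R) (C : set Tdd) : \bar R :=
  if `[< forall z w, C z -> C w -> edist2 z w <= del >]
  then (omega_2dm1 R d * (diam (C : set Rdd) / 2) ^+ (2 * d).-1)%:E else +oo%E.

Let hweight_ge0 del C : (0 <= hweight del C)%E.
Proof.
rewrite /hweight; case: ifP => // _.
by rewrite lee_fin mulr_ge0 ?omega_2dm1_ge0// exprn_ge0// divr_ge0// diam_ge0.
Qed.

Lemma diam0 : diam (set0 : set Rdd) = 0.
Proof.
rewrite /diam (_ : [set _ | _ in _ & _ in _] = set0) ?sup0//.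
by apply/seteqP; split=> // x [z []].
Qed.

(** A cover with a piece violating the mesh condition has infinite total weight, so admitting it
    does not change the infimum. *)
Lemma haus_deltaE (d0 : (0 < d)%N) (del : R) :
  haus_delta del = mu_ext (hweight del).
Proof.
apply/funext => A; apply/eqP; rewrite eq_le; apply/andP; split.
  apply: le_ereal_inf_tmp => _ [C [mC AC] <-].
  have [allC|/existsNP[k Ck]] :=
      pselect (forall j, forall z w, C j z -> C j w -> edist2 z w <= del).
    apply: ereal_inf_lbound; exists C; first by split.
    by apply: eq_eseriesr => j _; rewrite /hweight asboolT//; exact: allC.
  rewrite (@eseries_pinfty _ _ xpredT k) ?leey//.
    by move=> n _; rewrite -ltNye (lt_le_trans _ (hweight_ge0 _ _)).
  by rewrite /hweight asboolF.
apply: le_ereal_inf_tmp => _ [C [AC dC] <-].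
apply: ereal_inf_lbound; exists C.
  split=> // k; exact: sub_sigma_algebra.
by apply: eq_eseriesr => j _; rewrite /hweight asboolT//; exact: dC.
Qed.

(** Positivity of [d] makes the exponent [(2 * d).-1] nonzero; otherwise the empty set would
    contribute the power 0^0 = 1. *)
Let hweight0 (d0 : (0 < d)%N) del : hweight del set0 = 0%E.
Proof.
rewrite /hweight asboolT// diam0 mul0r expr0n.
by case: (d) d0 => // n _; rewrite mulnS/= mulr0.
Qed.

Lemma haus_delta_le del A A' : A `<=` A' -> (haus_delta del A <= haus_delta del A')%E.
Proof.
move=> AB; apply/ereal_inf_le_tmp => x [C [A'C dC]] <-; exists C => //.
by split=> //; exact: subset_trans AB A'C.
Qed.

Lemma haus_delta_ge0 (d0 : (0 < d)%N) del A : (0 <= haus_delta del A)%E.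
Proof. by rewrite haus_deltaE//; exact: (mu_ext_ge0 (hweight_ge0 del)). Qed.

Lemma haus_delta_sigma_subadditive (d0 : (0 < d)%N) del :
  sigma_subadditive (@haus_delta R d del).
Proof. by rewrite haus_deltaE//; exact: (mu_ext_sigma_subadditive (hweight_ge0 del)). Qed.

Lemma haus_delta0 (d0 : (0 < d)%N) del : haus_delta del (set0 : set Rdd) = 0%E.
Proof. by rewrite haus_deltaE//; exact: (mu_ext0 (hweight0 d0 del) (hweight_ge0 del)). Qed.

(** The one-piece cover [A, set0, set0, ...] is admissible; the halving of the diameter is given
    away. *)
Lemma haus_delta_le_small (d0 : (0 < d)%N) (del rho : R) A : 0 <= rho -> rho <= del ->
  (forall z w, A z -> A w -> edist2 z w <= rho) ->
  (haus_delta del A <= (omega_2dm1 R d * rho ^+ (2 * d).-1)%:E)%E.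
Proof.
move=> rho0 rdel dA.
have [A0|An0] := pselect (A = set0).
  rewrite A0 haus_delta0// lee_fin mulr_ge0 ?omega_2dm1_ge0 ?exprn_ge0//.
pose C (k : nat) : set Rdd := if k is 0%N then A else set0.
apply: (@le_trans _ _ ((omega_2dm1 R d * (diam A / 2) ^+ (2 * d).-1)%:E)).
  apply: ereal_inf_lbound; exists C.
    split; first by move=> z Az; exists 0%N.
    by move=> [|j] z w //= Az Aw; exact: le_trans (dA _ _ Az Aw) rdel.
  rewrite nneseries_recl//.
    rewrite eseries_cond/= eseries0 ?adde0// => -[|k]//= _ _.
    by rewrite diam0 mul0r expr0n; case: (d) d0 => // n _; rewrite mulnS/= mulr0.
  move=> k _; rewrite lee_fin mulr_ge0 ?omega_2dm1_ge0// exprn_ge0//.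
  by rewrite divr_ge0// diam_ge0.
rewrite lee_fin ler_wpM2l ?omega_2dm1_ge0// lerXn2r ?nnegrE//.
  by rewrite divr_ge0// diam_ge0.
have : diam A <= rho.
  apply: ge_sup.
    have /set0P[z Az] : A != set0 by apply/eqP.
    by exists (edist2 z z), z => //; exists z.
  by move=> _ [z Az [w Aw <-]]; exact: dA.
by have := diam_ge0 A; lra.
Qed.

Lemma hausdorff_ge (del : R) A : 0 < del -> (haus_delta del A <= hausdorff A)%E.
Proof. by move=> del0; apply: ereal_sup_ubound; exists del. Qed.

Lemma hausdorff_le_bound A (b : \bar R) :
  (forall del : R, 0 < del -> (haus_delta del A <= b)%E) -> (hausdorff A <= b)%E.
Proof. by move=> H; apply: ge_ereal_sup => _ [del del0 <-]; exact: H. Qed.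

Lemma le_hausdorff A A' : A `<=` A' -> (hausdorff A <= hausdorff A')%E.
Proof.
move=> AA'; apply: hausdorff_le_bound => del del0.
by apply: le_trans (hausdorff_ge _ del0); exact: haus_delta_le.
Qed.

Lemma hausdorff_ge0 (d0 : (0 < d)%N) A : (0 <= hausdorff A)%E.
Proof. exact: le_trans (haus_delta_ge0 d0 1 A) (hausdorff_ge _ ltr01). Qed.

Lemma hausdorff0 (d0 : (0 < d)%N) : hausdorff (set0 : set Rdd) = 0%E.
Proof.
apply/eqP; rewrite eq_le hausdorff_ge0// andbT.
by apply: hausdorff_le_bound => del _; rewrite haus_delta0.
Qed.

Lemma hausdorff_sigma_subadditive (d0 : (0 < d)%N) :
  sigma_subadditive (@hausdorff R d).
Proof.
move=> F; apply: hausdorff_le_bound => del del0.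
apply: le_trans (haus_delta_sigma_subadditive d0 _ _) _.
apply: lee_nneseries => *; first exact: haus_delta_ge0.
exact: hausdorff_ge.
Qed.

Definition hausdorff_outer (d0 : (0 < d)%N) : {outer_measure set Rdd -> \bar R} :=
  HB.pack (@hausdorff R d)
   (isOuterMeasure.Build R Rdd (@hausdorff R d) (hausdorff0 d0) (hausdorff_ge0 d0)
      le_hausdorff (hausdorff_sigma_subadditive d0)).

Definition haus_delta_outer (d0 : (0 < d)%N) del : {outer_measure set Rdd -> \bar R} :=
  HB.pack (@haus_delta R d del)
   (isOuterMeasure.Build R Rdd (@haus_delta R d del) (haus_delta0 d0 del)
      (haus_delta_ge0 d0 del) (@haus_delta_le del) (haus_delta_sigma_subadditive d0 del)).

End Hausdorff.

(** * Surface measure of boxes on the cone *)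

Lemma outer_measure_finite_cover (T : Type) (R : realType)
    (mu : {outer_measure set T -> \bar R}) (I : finType) (A : I -> set T) (X : set T) :
  (forall z, X z -> exists i, A i z) -> (mu X <= \sum_i mu (A i))%E.
Proof.
move=> XA; have : X `<=` \big[setU/set0]_i A i.
  move=> z /XA[i Aiz]; rewrite -bigcup_seq; exists i => //=.
  by rewrite mem_index_enum.
move/(le_outer_measure mu)/le_trans; apply.
elim: (index_enum I) => [|i s IH]; first by rewrite !big_nil outer_measure0.
rewrite !big_cons; apply: le_trans (outer_measureU2 _ _ _) _.
exact: leeD2l.
Qed.

(** Induction on [s]: the side in direction [j] is cut into [N] pieces of length [h], and [E]
    absorbs the constraint so obtained. Only directions in [s] are cut, whence the power
    [N ^ size s]. *)
Lemma outer_measure_grid (T : Type) (R : realType) (J : eqType)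
    (mu : {outer_measure set T -> \bar R}) (f : J -> T -> R) (N : nat) (h : R)
    (B : \bar R) (s : seq J) : 0 < h -> uniq s -> forall E : set T,
  (forall b : J -> R,
    (mu (E `&` [set z | forall j, j \in s -> (b j <= f j z < b j + h)%R]) <= B)%E) ->
  forall a : J -> R,
  (mu (E `&` [set z | forall j, j \in s -> (a j <= f j z < a j + N%:R * h)%R])
     <= (N ^ size s)%:R%:E * B)%E.
Proof.
move=> h0; elim: s => [|j s IH]/=.
  move=> _ E H a; rewrite expn0 mul1e; apply: le_trans (H a).
  by apply: le_outer_measure => z [].
move=> /andP[js us] E H a.
pose F (k : 'I_N) := (E `&` [set z | (a j + k%:R * h <= f j z < a j + k%:R * h + h)%R])
  `&` [set z | forall i, i \in s -> (a i <= f i z < a i + N%:R * h)%R].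
apply: (@le_trans _ _ (\sum_k mu (F k))%E).
  apply: outer_measure_finite_cover => z [Ez az].
  have /andP[ajz zaj] := az j (mem_head _ _).
  have x0 : 0 <= (f j z - a j) / h by rewrite divr_ge0 ?subr_ge0// ltW.
  have /andP[k1 k2] := truncn_itv x0.
  rewrite ler_pdivlMr// in k1; rewrite ltr_pdivrMr// -natr1 mulrDl mul1r in k2.
  have kN : (Num.truncn ((f j z - a j) / h) < N)%N.
    rewrite -(ltr_nat R) -(ltr_pM2r h0); apply: le_lt_trans k1 _; lra.
  exists (Ordinal kN) => /=; split; first split => //=.
    by apply/andP; split; lra.
  by move=> i si; apply: az; rewrite in_cons si orbT.
have FB k : (mu (F k) <= (N ^ size s)%:R%:E * B)%E.
  apply: (IH us) => b; pose b' i := if i == j then a j + k%:R * h else b i.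
  apply: le_trans (H b'); apply: le_outer_measure => z [[Ez zj] zs]; split => // i.
  rewrite in_cons /b'; case: eqVneq => [->//|_ /=]; exact: zs.
apply: (@le_trans _ _ (\sum_(k < N) ((N ^ size s)%:R%:E * B))%E).
  by apply: lee_sum => k _; exact: FB.
have B0 : (0 <= B)%E by apply: le_trans (H a); exact: outer_measure_ge0.
rewrite -(@ge0_sume_distrl _ _ _ B predT (fun=> (N ^ size s)%:R%:E))//.
by rewrite sumEFin sumr_const card_ord -mulrnA mulnC expnS.
Qed.

(** * Coordinates on the cone and the pieces where one of them can be solved for *)

Section Cone.
Variables (R : realType) (d : nat).
Notation Rdd := ('rV[R]_d * 'rV[R]_d)%type.
Notation idx := (bool * 'I_d)%type.
Implicit Types (z w : Rdd).

Definition pcoord (j : idx) z : R := (if j.1 then z.2 else z.1) ord0 j.2.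

(** [pcoord (dual j) z] is the partial derivative of x.y in coordinate [j]. *)
Definition dual (j : idx) : idx := (~~ j.1, j.2).

Lemma dualK : involutive dual.
Proof. by case=> b i; rewrite /dual/= negbK. Qed.

Lemma sum_idx (F : idx -> R) :
  \sum_j F j = \sum_(i < d) (F (true, i) + F (false, i)).
Proof.
rewrite big_split/= -(big_bool _ (fun b => \sum_i F (b, i))) pair_big/=.
by apply: eq_bigr => -[].
Qed.

Lemma enorm2E z : enorm2 z = Num.sqrt (\sum_j pcoord j z ^+ 2).
Proof.
by rewrite /enorm2 sum_idx addrC /edot -big_split.
Qed.

Lemma pcoordB j z w : pcoord j (z.1 - w.1, z.2 - w.2) = pcoord j z - pcoord j w.
Proof. by rewrite /pcoord; case: j => -[] i /=; rewrite !mxE. Qed.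

Lemma pcoord_le_enorm2 j z : `|pcoord j z| <= enorm2 z.
Proof.
rewrite enorm2E -sqrtr_sqr ler_sqrt ?sumr_ge0//; last by move=> *; exact: sqr_ge0.
by rewrite (bigD1 j)//= lerDl sumr_ge0// => *; exact: sqr_ge0.
Qed.

Lemma sum_sqr_le (I : Type) (s : seq I) (a : I -> R) :
  \sum_(i <- s) a i ^+ 2 <= (\sum_(i <- s) `|a i|) ^+ 2.
Proof.
elim: s => [|i s IH]; first by rewrite !big_nil expr0n.
rewrite !big_cons sqrrD real_normK ?num_real//.
have : 0 <= `|a i| * \sum_(j <- s) `|a j| by rewrite mulr_ge0// sumr_ge0.
lra.
Qed.

Lemma edist2_le z w : edist2 z w <= \sum_j `|pcoord j z - pcoord j w|.
Proof.
rewrite /edist2 enorm2E -[leRHS]ger0_norm ?sumr_ge0// -sqrtr_sqr.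
rewrite ler_wsqrtr//; under [X in X <= _]eq_bigr do rewrite pcoordB.
exact: sum_sqr_le.
Qed.

Lemma pcoord_eq0 z : (forall j, pcoord j z = 0) -> z = (0, 0).
Proof.
case: z => x y H; congr pair; apply/rowP => i; rewrite mxE.
  exact: (H (false, i)).
exact: (H (true, i)).
Qed.

(** Solve the linear relation for [D i]: every quotient [c j / c i] has modulus at most 1. *)
Lemma dominant_coeff_le (I : finType) (c D : I -> R) (i : I) :
  \sum_j c j * D j = 0 -> (forall j, `|c j| <= `|c i|) -> c i != 0 ->
  `|D i| <= \sum_(j | j != i) `|D j|.
Proof.
move=> s0 ci c0; rewrite -(ler_pM2l (x := `|c i|)) ?normr_gt0// -normrM.
move/eqP: s0; rewrite (bigD1 i)//= addr_eq0 => /eqP->; rewrite normrN.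
apply: le_trans (ler_norm_sum _ _ _) _; rewrite mulr_sumr.
by apply: ler_sum => j _; rewrite normrM ler_wpM2r.
Qed.

(** The piece of the cone where the derivative of x.y in coordinate [i] is the largest one, so that
    coordinate [i] is a Lipschitz function of the others. *)
Definition dominant (i : idx) : set Rdd :=
  [set z | Sigma_star z /\ forall j, `|pcoord j z| <= `|pcoord (dual i) z|].

Lemma dominant_cover z : Sigma_star z -> exists i, dominant i z.
Proof.
move=> Sz; have [j0 _|no] := pickP (@predT idx); last first.
  by case: Sz => _ []; apply: pcoord_eq0 => j; have := no j.
have [j _ jmax] := @arg_maxP _ _ _ j0 predT (fun j => `|pcoord j z|) isT.
by exists (dual j); split => // k; rewrite dualK; exact: jmax.
Qed.

Lemma dominant_neq0 i z : dominant i z -> pcoord (dual i) z != 0.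
Proof.
move=> [[_ z0] zi]; apply/eqP => zi0; apply: z0; apply: pcoord_eq0 => j.
by apply/eqP; rewrite -normr_le0; apply: le_trans (zi j) _; rewrite zi0 normr0.
Qed.

(* [x.y - x'.y'] is split asymmetrically so that the coefficient of the
   solved increment is the dominant pcoordinate of the larger point. *)
Lemma dominant_lipschitz i z w : dominant i z -> dominant i w ->
  `|pcoord i z - pcoord i w| <= \sum_(j | j != i) `|pcoord j z - pcoord j w|.
Proof.
wlog wz : z w / `|pcoord (dual i) w| <= `|pcoord (dual i) z|.
  move=> H Dz Dw; have [wz|/ltW zw] := leP `|pcoord (dual i) w| `|pcoord (dual i) z|.
    exact: H.
  by rewrite distrC; under eq_bigr do rewrite distrC; exact: H.
move=> Dz Dw.
pose c j := if j.1 == i.1 then pcoord (dual j) z else pcoord (dual j) w.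
apply: (@dominant_coeff_le _ c).
- rewrite sum_idx /c /dual/=.
  transitivity (edot z.1 z.2 - edot w.1 w.2); last first.
    by case: Dz => -[-> _] _; case: Dw => -[-> _] _; rewrite subr0.
  rewrite /edot -sumrB; apply: eq_bigr => k _.
  by case: (i) => -[] i0; rewrite /pcoord/=; ring.
- move=> j; rewrite /c eqxx; case: eqP => _; first exact: Dz.2.
  by apply: le_trans wz; exact: Dw.2.
- by rewrite /c eqxx; exact: dominant_neq0.
Qed.

Definition box (al : idx -> R) (rho : R) : set Rdd :=
  [set z | forall j, al j <= pcoord j z < al j + rho].

(** There are [2 * d] dominant pieces, each cut into cells of diameter at most [4 * d%:R] times
    their side. *)
Definition boxC : R := (2 * d)%:R * (omega_2dm1 R d * (4 * d%:R) ^+ (2 * d).-1).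

(** Only the [(2 * d).-1] coordinates other than [i] are cut into intervals of length [h = rho / N].
    Coordinate [i] varies by at most the sum of the others, so a cell has diameter at most 2(2d-1)h,
    hence at most 4dh. [N] is large enough to make this at most [del]; the number of cells then
    cancels the powers of [N], and the bound is free of [del]. *)
Lemma haus_delta_dominant_box (d0 : (0 < d)%N) (del rho : R) (al : idx -> R) (i : idx) :
  0 < del -> 0 < rho ->
  (haus_delta del (dominant i `&` box al rho) <=
     (omega_2dm1 R d * (4 * d%:R * rho) ^+ (2 * d).-1)%:E)%E.
Proof.
move=> del0 rho0.
pose N := (Num.truncn (4 * d%:R * rho / del)).+1.
have N0 : 0 < N%:R :> R by rewrite ltr0n.
have dR : 0 < d%:R :> R by rewrite ltr0n.
pose h := rho / N%:R.
have h0 : 0 < h by rewrite divr_gt0.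
have rhoE : rho = N%:R * h by rewrite /h mulrC divfK// gt_eqF.
have hdel : 4 * d%:R * h <= del.
  rewrite /h mulrA ler_pdivrMr// [leRHS]mulrC -ler_pdivrMr//.
  have /andP[_ /ltW] := truncn_itv (x := 4 * d%:R * rho / del)
    (divr_ge0 (mulr_ge0 (mulr_ge0 (ler0n _ 4) (ltW dR)) (ltW rho0)) (ltW del0)).
  exact.
pose s := enum (predC1 i).
have szs : size s = (2 * d).-1.
  by rewrite -cardE cardC1 card_prod card_bool card_ord.
have H (b : idx -> R) : (haus_delta_outer d0 del (dominant i `&`
   [set z | forall j, j \in s -> (b j <= pcoord j z < b j + h)%R]) <=
   (omega_2dm1 R d * (4 * d%:R * h) ^+ (2 * d).-1)%:E)%E.
  apply: haus_delta_le_small => //.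
    by rewrite !mulr_ge0// ?ltW.
  move=> z w [Dz zb] [Dw wb]; apply: le_trans (edist2_le _ _) _.
  rewrite (bigD1 i)//=; apply: le_trans (lerD (dominant_lipschitz Dz Dw) (lexx _)) _.
  have : \sum_(j | j != i) `|pcoord j z - pcoord j w| <= \sum_(j | j != i) h.
    apply: ler_sum => j ji.
    have js : j \in s by rewrite mem_enum.
    have /andP[? ?] := zb j js; have /andP[? ?] := wb j js.
    by rewrite ler_norml; apply/andP; split; lra.
  rewrite sumr_const cardC1 card_prod card_bool card_ord => L.
  have : h *+ (2 * d).-1 <= 2 * d%:R * h.
    have L1 : (2 * d).-1%:R <= 2 * d%:R :> R.
      by rewrite -[2]/(2%:R) -(natrM R 2 d) ler_nat leq_pred.
    by rewrite -mulr_natl ler_wpM2r// ltW.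
  lra.
have := @outer_measure_grid _ _ _ _ pcoord N h _ s h0 (enum_uniq _) _ H al.
rewrite -rhoE => G; apply: le_trans (le_trans _ G) _.
  by apply: haus_delta_le => z [Dz bz]; split.
rewrite szs -EFinM lee_fin rhoE natrX mulrCA -exprMn.
by rewrite (_ : _ * (4 * _ * h) = 4 * d%:R * (N%:R * h)); last by ring.
Qed.

Lemma hausdorff_box (d0 : (0 < d)%N) (al : idx -> R) (rho : R) : 0 < rho ->
  (hausdorff (@Sigma_star R d `&` box al rho) <= (boxC * rho ^+ (2 * d).-1)%:E)%E.
Proof.
move=> rho0; apply: hausdorff_le_bound => del del0.
apply: le_trans (@outer_measure_finite_cover _ _ (haus_delta_outer d0 del) _
  (fun i => dominant i `&` box al rho) _ _) _.
  by move=> z [/dominant_cover[i Dz] bz]; exists i.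
apply: le_trans (lee_sum _ (fun i _ => haus_delta_dominant_box d0 al i del0 rho0)) _.
rewrite sumEFin sumr_const card_prod card_bool card_ord lee_fin /boxC.
by rewrite -[leLHS]mulr_natl (exprMn _ (4 * d%:R) rho) !mulrA.
Qed.

End Cone.

(** * The layer-cake surface integral *)

(** By monotonicity, preimages of the generating rays are intervals. *)
Lemma nonincreasing_emeasurable (R : realType) (D : set R) (f : R -> \bar R) :
  measurable D -> {homo f : x y / x <= y >-> (y <= x)%E} -> measurable_fun D f.
Proof.
move=> mD f_ni; apply: (measurability (@ErealGenCInfty.G R)).
  exact: ErealGenCInfty.measurableE.
move=> /= _ [_] [r] -> <-.
apply: measurableI => //; apply: is_interval_measurable => s t/=.
rewrite !in_itv/= !andbT => fs ft u /andP[su ut].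
by rewrite in_itv/= andbT (le_trans ft)// f_ni.
Qed.

(** The image of Lebesgue measure under dilation by [c] is [c^-1] times Lebesgue measure: multiplied
    by [c], it has the right value on half-open intervals, and uniqueness applies. *)
Lemma ge0_integral_dilate (R : realType) (c : R) (phi : R -> \bar R) : 0 < c ->
  measurable_fun setT phi -> (forall t, (0 <= phi t)%E) ->
  (\int[@lebesgue_measure R]_(t in `]0%R, +oo[) phi (c * t)%R)%E =
  (c^-1%:E * \int[@lebesgue_measure R]_(t in `]0%R, +oo[) phi t)%E.
Proof.
move=> c0 mphi phi0.
have ci0 : 0 <= c^-1 by rewrite invr_ge0 ltW.
pose k : {nonneg R} := NngNum ci0.
pose dil : measurableTypeR R -> measurableTypeR R := fun t : R => c * t.
have mdil : measurable_fun setT dil by exact: mulrl_measurable.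
have c'0 : 0 <= c by rewrite ltW.
pose k' : {nonneg R} := NngNum c'0.
pose push : {measure set (measurableTypeR R) -> \bar R} :=
  measure_function_pushforward__canonical__measure_function_Measure
    (@lebesgue_measure R) mdil.
have pushE (A : set (measurableTypeR R)) : measurable A ->
    push A = mscale k (@lebesgue_measure R) A.
  move=> mA.
  have leb : lebesgue_measure A =
      mscale k' push A.
    refine (@lebesgue_measure_unique R (mscale k' push) _ A mA) => _ [[a b]] _ <-.
    transitivity (c%:E * lebesgue_measure (dil @^-1` `]a, b]%classic))%E; last by [].
    have -> : dil @^-1` `]a, b]%classic = `]a / c, b / c]%classic.
      apply/seteqP; split=> x; rewrite /dil/= !in_itv/=.
        by rewrite ltr_pdivrMr// ler_pdivlMr// ![x * c]mulrC.
      by rewrite ltr_pdivrMr// ler_pdivlMr// ![x * c]mulrC.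
    rewrite !lebesgue_measure_itv/= !lte_fin ltr_pM2r ?invr_gt0//.
    case: ifP => _; last by rewrite mule0.
    by rewrite -!EFinB -EFinM -mulrBl mulrC divfK ?gt_eqF.
  by rewrite /mscale/= leb /mscale/= muleA -EFinM mulVf ?gt_eqF// mul1e.
have preD : dil @^-1` `]0%R, +oo[%classic = `]0%R, +oo[%classic.
  by apply/seteqP; split=> x; rewrite /dil/= !in_itv/= !andbT pmulr_rgt0.
have mphi' : measurable_fun (`]0%R, +oo[%classic : set (measurableTypeR R)) phi.
  exact: measurable_funTS.
rewrite -[in LHS]preD.
rewrite -(@ge0_integral_pushforward _ _ _ _ _ dil mdil (@lebesgue_measure R) _ phi)//.
rewrite (@eq_measure_integral _ _ _ _ (mscale k (@lebesgue_measure R))).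
  by rewrite ge0_integral_mscale.
by move=> A mA _; exact: pushE.
Qed.

Section SurfaceIntegral.
Variables (R : realType) (d : nat) (d0 : (0 < d)%N).
Notation Rdd := ('rV[R]_d * 'rV[R]_d)%type.
Notation Sigma := (@Sigma_star R d).
Implicit Types (f g h : Rdd -> R) (z : Rdd).

(** The distribution function of [g]: it is nonincreasing, hence measurable for arbitrary [g]. *)
Let tail g t : \bar R := hausdorff (Sigma `&` [set z | t < g z]).

Let tail_ge0 g t : (0 <= tail g t)%E.
Proof. exact: hausdorff_ge0. Qed.

Let tail_ni g : {homo tail g : x y / x <= y >-> (y <= x)%E}.
Proof.
move=> x y xy; apply: le_hausdorff => z [Sz /= yz]; split => //=.
exact: le_lt_trans yz.
Qed.

Let tail_measT g : measurable_fun setT (tail g).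
Proof. exact: (nonincreasing_emeasurable measurableT (@tail_ni g)). Qed.

Let tail_meas g : measurable_fun (`]0%R, +oo[%classic : set (measurableTypeR R)) (tail g).
Proof. exact: measurable_funTS (tail_measT g). Qed.

Let le_int_tail g (psi : R -> \bar R) :
  measurable_fun (`]0%R, +oo[%classic : set (measurableTypeR R)) psi ->
  (forall t, 0 < t -> (tail g t <= psi t)%E) ->
  (surf_int_nonneg g <= \int[@lebesgue_measure R]_(t in `]0%R, +oo[) psi t)%E.
Proof.
move=> mpsi gpsi; apply: ge0_le_integral => //.
- by move=> t _; exact: tail_ge0.
- exact: tail_meas.
- by move=> t; rewrite /= in_itv/= andbT; exact: gpsi.
Qed.

Lemma surf_int_ge0 g : (0 <= surf_int_nonneg g)%E.
Proof. by apply: integral_ge0 => t _; exact: tail_ge0. Qed.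

Lemma surf_int_le f g : (forall z, Sigma z -> f z <= g z) ->
  (surf_int_nonneg f <= surf_int_nonneg g)%E.
Proof.
move=> fg; apply: (le_int_tail (tail_meas g)) => t _.
apply: le_hausdorff => z [Sz tf]; split => //=.
exact: lt_le_trans (fg _ Sz).
Qed.

(** The distribution function is at most [B] up to height [c] and vanishes above it. *)
Lemma surf_int_cell g (E : set Rdd) (c B : R) : 0 <= c -> 0 <= B ->
  (forall z, Sigma z -> 0 < g z -> E z /\ g z <= c) ->
  (hausdorff (Sigma `&` E) <= B%:E)%E -> (surf_int_nonneg g <= (c * B)%:E)%E.
Proof.
move=> c0 B0 gE HE.
pose A : set (measurableTypeR R) := `]0%R, c]%classic.
have mA : measurable A by exact: measurable_itv.
apply: (@le_trans _ _
  (\int[@lebesgue_measure R]_(t in `]0%R, +oo[) (B%:E * (\1_A t)%:E))%E).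
  apply: le_int_tail => [|t t0].
    by apply: measurable_funeM; apply/measurable_EFinP; exact: measurable_indic.
  rewrite indicE; have [tc|ct] := leP t c.
    rewrite mem_set/= ?mule1; last by rewrite /A/= in_itv/= t0 tc.
    apply: le_trans HE; apply: le_hausdorff => z [Sz tg]; split => //.
    by have [] := gE z Sz (lt_trans t0 tg).
  rewrite /tail (_ : _ `&` _ = set0) ?hausdorff0//.
    by rewrite mule_ge0// lee_fin.
  apply/seteqP; split=> // z [Sz] /= tg.
  by have [_] := gE z Sz (lt_trans t0 tg); lra.
rewrite ge0_integralZl_EFin//; last first.
  by apply/measurable_EFinP; exact: measurable_indic.
rewrite integral_indic// (_ : A `&` _ = A).
  have LA : (lebesgue_measure A <= c%:E)%E.
    by rewrite /A lebesgue_measure_itv/= lte_fin; case: ifP; rewrite ?oppr0 ?adde0.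
  by rewrite mulrC EFinM; apply: lee_wpmul2l LA; rewrite lee_fin.
by apply: setIidl => x; rewrite /A/= !in_itv/= => /andP[->].
Qed.

(** Each superlevel set of [g] lies in the union of those of the [gk k]; countable subadditivity
    passes to the integrals because the sum and the integral in [t] commute. *)
Lemma surf_int_pieces g (gk : nat -> Rdd -> R) :
  (forall z, Sigma z -> 0 < g z -> exists k, g z <= gk k z) ->
  (surf_int_nonneg g <= \sum_(k <oo) surf_int_nonneg (gk k))%E.
Proof.
move=> ggk; apply: (@le_trans _ _
  (\int[@lebesgue_measure R]_(t in `]0%R, +oo[) \sum_(k <oo) tail (gk k) t)%E); last first.
  by rewrite integral_nneseries.
apply: le_int_tail => [|t t0].
  by apply: ge0_emeasurable_sum => [k t _ _|k _]; [exact: tail_ge0|exact: tail_meas].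
apply: le_trans (hausdorff_sigma_subadditive d0 _).
apply: le_hausdorff => z [Sz tg]; have [k gz] := ggk z Sz (lt_trans t0 tg).
by exists k => //; split => //=; exact: lt_le_trans tg gz.
Qed.

Lemma surf_int_max g f h :
  (forall z, Sigma z -> g z <= f z \/ g z <= h z) ->
  (surf_int_nonneg g <= surf_int_nonneg f + surf_int_nonneg h)%E.
Proof.
move=> gfh; apply: (@le_trans _ _
  (\int[@lebesgue_measure R]_(t in `]0%R, +oo[) (tail f t + tail h t))%E).
- apply: le_int_tail => [|t t0].
    by apply: emeasurable_funD; exact: tail_meas.
  apply: le_trans (outer_measureU2 (hausdorff_outer R d0) _ _).
  apply: le_hausdorff => z [Sz tg].
  by have [gz|gz] := gfh z Sz; [left|right]; split => //=; exact: lt_le_trans tg gz.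
- rewrite ge0_integralD//; solve [exact: tail_meas|by move=> t _; exact: tail_ge0].
Qed.

Lemma surf_int_scale g c : 0 < c ->
  surf_int_nonneg (fun z => c * g z) = (c%:E * surf_int_nonneg g)%E.
Proof.
move=> c0; rewrite /surf_int_nonneg.
have := @ge0_integral_dilate R c^-1 (tail g) _ (tail_measT g) (tail_ge0 g).
rewrite invr_gt0 invrK => /(_ c0) <-; apply: eq_integral => t _.
congr hausdorff; apply/seteqP; split=> z [Sz] /=; split => //=.
  by rewrite ltr_pdivrMl.
by rewrite -ltr_pdivrMl.
Qed.

(* [f + h] is at most [(1 + e) f] or at most [(1 + 1/e) h]; this replaces
   additivity of the integral, which would require measurability. *)
Lemma surf_int_add (e : R) g f h : 0 < e ->
  (forall z, Sigma z -> g z <= f z + h z) ->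
  (surf_int_nonneg g <=
    (1 + e)%:E * surf_int_nonneg f + (1 + e^-1)%:E * surf_int_nonneg h)%E.
Proof.
move=> e0 gfh; have ei0 : 0 < e^-1 by rewrite invr_gt0.
rewrite -!surf_int_scale ?addr_gt0//; apply: surf_int_max => z Sz.
have := gfh z Sz; have [hf|fh] := leP (h z) (e * f z).
  by left; lra.
right; have : f z <= e^-1 * h z by rewrite ler_pdivlMl// ltW.
lra.
Qed.

Lemma surf_int_add2 g f h (a b : R) :
  (forall z, Sigma z -> g z <= f z + h z) ->
  (surf_int_nonneg f <= a%:E)%E -> (surf_int_nonneg h <= b%:E)%E ->
  (surf_int_nonneg g <= (2 * a + 2 * b)%:E)%E.
Proof.
move=> gfh fa hb; apply: le_trans (surf_int_add ltr01 gfh) _.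
rewrite invr1 (_ : (2 * a + 2 * b)%:E = (1 + 1)%:E * a%:E + (1 + 1)%:E * b%:E)%E.
  by apply: leeD; apply: lee_wpmul2l => //; rewrite lee_fin.
by [].
Qed.

(** In [surf_int_add] the splitting parameter is [eta] itself: the surplus is eta B from the main
    term and (1 + 1/eta) eta^2 = eta^2 + eta from [h]. This is why [h] is required to have integral
    at most [eta ^+ 2]. *)
Lemma surf_int_fine_diff f g h (B eta : R) : 0 < eta ->
  (forall z, Sigma z -> `|f z - g z| <= h z) ->
  (surf_int_nonneg f <= B%:E)%E -> (surf_int_nonneg g <= B%:E)%E ->
  (surf_int_nonneg h <= (eta ^+ 2)%:E)%E ->
  `|fine (surf_int_nonneg f) - fine (surf_int_nonneg g)| <= eta * (B + 1 + eta).
Proof.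
move=> eta0.
have sym (f' g' : Rdd -> R) : (forall z, Sigma z -> f' z <= g' z + h z) ->
    (surf_int_nonneg f' <= B%:E)%E -> (surf_int_nonneg g' <= B%:E)%E ->
    (surf_int_nonneg h <= (eta ^+ 2)%:E)%E ->
    fine (surf_int_nonneg f') - fine (surf_int_nonneg g') <= eta * (B + 1 + eta).
  move=> fgh fB gB hB; have := surf_int_add eta0 fgh.
  have fin (u : Rdd -> R) b : (surf_int_nonneg u <= b%:E)%E -> surf_int_nonneg u \is a fin_num.
    by move=> ub; rewrite (ge0_fin_numE (surf_int_ge0 _)) (le_lt_trans ub)// ltry.
  move: fB gB hB (fin _ _ fB) (fin _ _ gB) (fin _ _ hB).
  move: (surf_int_nonneg f') (surf_int_nonneg g') (surf_int_nonneg h)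
    => [a||] [b||] [c||]//=.
  rewrite !lee_fin => aB bB cB _ _ _.
  have : (1 + eta^-1) * c <= (1 + eta^-1) * eta ^+ 2.
    by rewrite ler_wpM2l// addr_ge0// invr_ge0 ltW.
  have -> : (1 + eta^-1) * eta ^+ 2 = eta ^+ 2 + eta by field; rewrite gt_eqF.
  have : eta * b <= eta * B by rewrite ler_wpM2l// ltW.
  by move=> ? ? ?; lra.
move=> fgh fB gB hB; rewrite ler_norml; apply/andP; split.
  rewrite -opprB lerN2; apply: sym => // z Sz.
  by have := fgh z Sz; rewrite ler_norml => /andP[]; lra.
by apply: sym => // z Sz; have := fgh z Sz; rewrite ler_norml => /andP[]; lra.
Qed.

End SurfaceIntegral.

(** * Weights and series *)

Section Series.
Variable R : realType.

Lemma nneseries_le_bound (u : nat -> R) (C : R) : (forall k, 0 <= u k) ->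
  (forall n, \sum_(k < n) u k <= C) -> (\sum_(k <oo) (u k)%:E <= C%:E)%E.
Proof.
move=> u0 uC; apply: lime_le.
  by apply: is_cvg_nneseries => k _ _; rewrite lee_fin.
by apply: nearW => n; rewrite big_mkord sumEFin lee_fin.
Qed.

Lemma ler_powRN (a b q : R) : 0 <= q -> 0 < a -> a <= b -> b `^ (- q) <= a `^ (- q).
Proof.
move=> q0 a0 ab; have b0 := lt_le_trans a0 ab.
rewrite !powRN lef_pV2 ?posrE ?powR_gt0//.
by apply: ge0_ler_powR => //; rewrite nnegrE ltW.
Qed.

(** With t = ln((a+1)/a), which is at least 1/(a+1), the left power is (a+1)^-q exp(qt), and exp(qt)
    >= 1 + qt. *)
Lemma powRN_telescope (q a : R) : 0 < q -> 0 < a ->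
  q * (a + 1) `^ (- (q + 1)) <= a `^ (- q) - (a + 1) `^ (- q).
Proof.
move=> q0 a0; have b0 : 0 < a + 1 by rewrite addr_gt0.
pose t := ln (a + 1) - ln a.
have tE : expR (- t) = a / (a + 1).
  by rewrite /t opprB expRB !lnK ?posrE.
have t1 : (a + 1)^-1 <= t.
  have := expR_ge1Dx (- t); rewrite tE.
  have -> : a / (a + 1) = 1 - (a + 1)^-1 by field; rewrite gt_eqF.
  lra.
have aE : a `^ (- q) = (a + 1) `^ (- q) * expR (q * t).
  rewrite /powR !gt_eqF// -expRD; congr expR; rewrite /t; ring.
have bE : (a + 1) `^ (- (q + 1)) = (a + 1) `^ (- q) * (a + 1)^-1.
  rewrite opprD powRD; last by rewrite (gt_eqF b0) implybT.
  by rewrite powR_inv1// ltW.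
rewrite aE bE; have P0 : 0 <= (a + 1) `^ (- q) by exact: powR_ge0.
have : q * (a + 1)^-1 <= expR (q * t) - 1.
  apply: (@le_trans _ _ (q * t)); first by rewrite ler_wpM2l// ltW.
  by have := expR_ge1Dx (q * t); lra.
move=> /(ler_wpM2l P0); lra.
Qed.

(** Integral test: [powRN_telescope] with [q = p - 1] makes all terms after the first telescope. The
    induction carries the remainder, which is dropped at the end. *)
Lemma riemann_sum_le (p : R) n : 1 < p ->
  \sum_(k < n) k.+1%:R `^ (- p) <= 1 + (p - 1)^-1.
Proof.
move=> p1; have q0 : 0 < p - 1 by rewrite subr_gt0.
have qi0 : 0 < (p - 1)^-1 by rewrite invr_gt0.
case: n => [|n]; first by rewrite big_ord0; lra.
suff : \sum_(k < n.+1) k.+1%:R `^ (- p) <= 1 + (p - 1)^-1 * (1 - n.+1%:R `^ (- (p - 1))).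
  have : 0 <= (p - 1)^-1 * n.+1%:R `^ (- (p - 1)).
    by rewrite mulr_ge0 ?powR_ge0// ltW.
  lra.
elim: n => [|n IH].
  by rewrite big_ord_recr big_ord0/= !powR1 subrr; lra.
rewrite big_ord_recr/=; have := powRN_telescope q0 (ltr0Sn R n).
rewrite natr1 subrK => /(ler_wpM2l (ltW qi0)).
rewrite mulrA mulVf ?gt_eqF//; lra.
Qed.

Lemma geometric_half_sum_le n : \sum_(k < n) (2^-1 : R) ^+ k <= 2.
Proof.
suff -> : \sum_(k < n) (2^-1 : R) ^+ k = 2 - 2 * 2^-1 ^+ n.
  have : 0 <= (2^-1 : R) ^+ n by rewrite exprn_ge0.
  lra.
elim: n => [|n IH]; first by rewrite big_ord0 expr0; lra.
by rewrite big_ord_recr/= IH exprS; lra.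
Qed.

End Series.

(** * One-dimensional brackets on unit cells *)

Section Weights.
Variable R : realType.

Definition jbr1 (u : R) : R := Num.sqrt (1 + u ^+ 2).

Lemma jbr1_ge1 u : 1 <= jbr1 u.
Proof. by rewrite -[leLHS]sqrtr1 ler_wsqrtr// lerDl sqr_ge0. Qed.

Lemma jbr1_ge (u : R) (m : nat) : m%:R <= `|u| -> m.+1%:R / 2 <= jbr1 u.
Proof.
move=> mu; have m0 : 0 <= m%:R :> R by [].
rewrite -[leLHS]ger0_norm ?divr_ge0// -sqrtr_sqr ler_wsqrtr//.
rewrite -natr1 -(real_normK (num_real u)).
have : m%:R ^+ 2 <= `|u| ^+ 2 by rewrite ler_sqr ?nnegrE.
have : 0 <= (m%:R - 1) ^+ 2 :> R by exact: sqr_ge0.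
have : 0 <= m%:R ^+ 2 :> R by exact: sqr_ge0.
rewrite sqrrB; rewrite !expr2; lra.
Qed.

(** Enumerates the integers as -1, 0, -2, 1, -3, 2, ..., so that the unit cell number [k] lies at
    distance [k./2] from the origin. *)
Definition cell_start (k : nat) : R :=
  if odd k then (k./2)%:R else - (k./2).+1%:R.

Lemma cell_cover (u : R) : exists k, cell_start k <= u <= cell_start k + 1.
Proof.
have [u0|u0] := leP 0 u.
  exists (Num.truncn u).*2.+1; rewrite /cell_start/= odd_double/= uphalf_double.
  have /andP[-> /ltW] := truncn_itv u0; by rewrite natr1.
have u1 : 0 <= - u by lra.
exists (Num.truncn (- u)).*2; rewrite /cell_start odd_double doubleK.
have /andP[] := truncn_itv u1; rewrite -natr1 => ? ?; apply/andP; split; lra.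
Qed.

(** The distance [k./2] gives the lower bound [(k./2).+1%:R / 2] by [jbr1_ge]; passing from [k./2]
    to [k] costs another factor 2. *)
Lemma jbr1_cell_ge (k : nat) u : cell_start k <= u <= cell_start k + 1 ->
  k.+1%:R / 4 <= jbr1 u.
Proof.
move=> ku; apply: (@le_trans _ _ ((k./2).+1%:R / 2)).
  have : k.+1%:R <= 2 * (k./2).+1%:R :> R.
    rewrite -[2]/(2%:R) -(natrM R 2) ler_nat mul2n doubleS.
    by rewrite -{1}(odd_double_half k); case: (odd k).
  lra.
apply: jbr1_ge; move: ku; rewrite /cell_start; case: ifP => _ /andP[].
  by move=> ku _; apply: le_trans ku _; exact: ler_norm.
rewrite -natr1 => _ uk; rewrite -normrN; apply: le_trans _ (ler_norm _); lra.
Qed.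

(** Bounds the sum over all unit cells of the supremum of the weight with exponent [- p]: 4^p comes
    from [jbr1_cell_ge], the rest from [riemann_sum_le]. *)
Definition weightC (p : R) : R := 4 `^ p * (1 + (p - 1)^-1).

End Weights.

(** * Integrals of products of weights *)

Section Bounds.
Variables (R : realType) (d : nat) (d0 : (0 < d)%N).
Notation Rd := ('rV[R]_d).
Notation Rdd := ('rV[R]_d * 'rV[R]_d)%type.
Notation Sigma := (@Sigma_star R d).
Notation idx := (bool * 'I_d)%type.

Lemma weightC_ge0 (p : R) : 1 < p -> 0 <= weightC p.
Proof.
move=> p1; rewrite mulr_ge0 ?powR_ge0// addr_ge0// invr_ge0 subr_ge0; exact: ltW.
Qed.

(** Induction on [s]: split according to the unit cell that contains [f j z]. On cell [k] the factor
    of [j] is at most [ck k] and joins [c], while the cell condition joins [E]; summing over [k]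
    costs one [weightC p]. *)
Lemma surf_int_product_weight (J : eqType) (f : J -> Rdd -> R) (p B : R) (s : seq J) :
  1 < p -> 0 <= B -> uniq s -> forall (E : set Rdd) (c : R) (g : Rdd -> R), 0 <= c ->
  (forall b : J -> R, (hausdorff (Sigma `&`
     (E `&` [set z | forall j, j \in s -> (b j <= f j z <= b j + 1)%R])) <= B%:E)%E) ->
  (forall z, Sigma z -> 0 < g z ->
     E z /\ g z <= c * \prod_(j <- s) jbr1 (f j z) `^ (- p)) ->
  (surf_int_nonneg g <= (c * B * weightC p ^+ size s)%:E)%E.
Proof.
move=> p1 B0; have C0 := weightC_ge0 p1.
elim: s => [|j s IH] us E c g c0 HE gE.
  rewrite expr0 mulr1; apply: (surf_int_cell d0 (E := E)) => //.
    move=> z Sz gz; have [Ez] := gE z Sz gz.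
    by rewrite big_nil mulr1.
  apply: le_trans (HE (fun=> 0)); apply: le_hausdorff => z [Sz Ez]; split => //.
move: us => /= /andP[js us].
pose F k : set Rdd := [set z | cell_start R k <= f j z <= cell_start R k + 1].
pose gk (k : nat) z := if cell_start R k <= f j z <= cell_start R k + 1 then g z else 0.
pose ck (k : nat) : R := 4 `^ p * k.+1%:R `^ (- p).
have ck0 k : 0 <= ck k by rewrite mulr_ge0 ?powR_ge0.
have gkB k : (surf_int_nonneg (gk k) <= (c * B * weightC p ^+ size s * ck k)%:E)%E.
  rewrite -mulrAC -[_ * B * ck k]mulrAC.
  apply: (IH us (E `&` F k)).
  - by rewrite mulr_ge0.
  - move=> b; pose b' i := if i == j then cell_start R k else b i.
    apply: le_trans (HE b'); apply: le_hausdorff => z [Sz [[Ez Fz] bz]].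
    split => //; split => // i; rewrite in_cons /b'.
    by case: eqVneq => [->//|_ /=]; exact: bz.
  - move=> z Sz; rewrite /gk; case: ifPn => [kz|_]; last by rewrite ltxx.
    move=> gz; have [Ez gz'] := gE z Sz gz; split => //.
    apply: le_trans gz' _; rewrite big_cons mulrA ler_wpM2r//.
      by apply: prodr_ge0 => *; exact: powR_ge0.
    rewrite ler_wpM2l// /ck.
    have := jbr1_cell_ge kz; move/(ler_powRN (ltW (lt_trans ltr01 p1)))/le_trans.
    apply; first by rewrite divr_gt0.
    rewrite powRM ?invr_ge0// -(powR_inv1 (ler0n R 4)) -powRrM mulN1r opprK.
    by rewrite mulrC.
apply: le_trans (@surf_int_pieces _ _ d0 g gk _) _.
  move=> z Sz gz; have [k kz] := cell_cover (f j z); exists k.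
  by rewrite /gk kz.
apply: (@le_trans _ _ (\sum_(k <oo) (c * B * weightC p ^+ size s * ck k)%:E)%E).
  apply: lee_nneseries => k *; [exact: surf_int_ge0|exact: gkB].
apply: nneseries_le_bound => [k|n].
  by rewrite !mulr_ge0// exprn_ge0.
rewrite -mulr_sumr exprSr mulrA ler_wpM2l ?mulr_ge0 ?exprn_ge0//.
rewrite /ck -mulr_sumr /weightC ler_wpM2l ?powR_ge0//.
exact: riemann_sum_le.
Qed.

Definition decay (r : R) (a : Rd) : R := jbr a `^ (- r).

Lemma edotE (a : Rd) : edot a a = \sum_i a ord0 i ^+ 2.
Proof. by []. Qed.

Lemma edot_ge0 (a : Rd) : 0 <= edot a a.
Proof. by rewrite edotE sumr_ge0// => *; exact: sqr_ge0. Qed.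

Lemma enorm_sqr (a : Rd) : enorm a ^+ 2 = edot a a.
Proof. by rewrite sqr_sqrtr// edot_ge0. Qed.

Lemma enorm_ge0 (a : Rd) : 0 <= enorm a.
Proof. exact: sqrtr_ge0. Qed.

Lemma jbr_ge1 (a : Rd) : 1 <= jbr a.
Proof. by rewrite -[leLHS]sqrtr1 ler_wsqrtr// lerDl sqr_ge0. Qed.

Lemma jbr_gt0 (a : Rd) : 0 < jbr a.
Proof. exact: lt_le_trans (jbr_ge1 a). Qed.

Lemma jbr1_le_jbr (a : Rd) i : jbr1 (a ord0 i) <= jbr a.
Proof.
rewrite ler_wsqrtr// lerD2l enorm_sqr edotE (bigD1 i)//= lerDl.
by rewrite sumr_ge0// => *; exact: sqr_ge0.
Qed.

Lemma decay_ge0 r a : 0 <= decay r a.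
Proof. exact: powR_ge0. Qed.

(** The bracket of [a] dominates that of each of its [d] coordinates, and each receives the share
    [r / d%:R] of the exponent, which exceeds 1 when r > d. *)
Lemma decay_le_prod (r : R) (a : Rd) : 0 <= r ->
  decay r a <= \prod_(i < d) jbr1 (a ord0 i) `^ (- (r / d%:R)).
Proof.
move=> r0; have dR : 0 < d%:R :> R by rewrite ltr0n.
have -> : decay r a = \prod_(i < d) jbr a `^ (- (r / d%:R)).
  rewrite prodr_const card_ord -powR_mulrn ?powR_ge0// -powRrM.
  by rewrite mulNr divfK ?gt_eqF.
apply: ler_prod => i _; rewrite powR_ge0/=; apply: ler_powRN.
- by rewrite divr_ge0// ltW.
- by apply: lt_le_trans (jbr1_ge1 _).
- exact: jbr1_le_jbr.
Qed.

Definition pairC (r : R) : R :=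
  boxC R d * 3 ^+ (2 * d).-1 * weightC (r / d%:R) ^+ (2 * d).

Lemma boxC_ge0 : 0 <= boxC R d.
Proof.
by rewrite /boxC mulr_ge0// mulr_ge0 ?omega_2dm1_ge0// exprn_ge0// mulr_ge0.
Qed.

(** The hypothesis says that [al z] and [be z] together determine [z] up to a bounded error. A
    coordinate of [z] is one cell value or a difference of two, so it ranges over a closed interval
    of length at most 2, which fits into a half-open one of length 3. *)
Lemma surf_int_decay_pair (r : R) (al be : Rdd -> Rd) : d%:R < r ->
  (forall b : idx -> R, exists c : idx -> R, forall z,
     (forall i, b (false, i) <= al z ord0 i <= b (false, i) + 1 /\
                b (true, i) <= be z ord0 i <= b (true, i) + 1) -> box c 3 z) ->
  (surf_int_nonneg (fun z => decay r (al z) * decay r (be z))%R <= (pairC r)%:E)%E.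
Proof.
move=> dr H; have dR : 0 < d%:R :> R by rewrite ltr0n.
have p1 : 1 < r / d%:R by rewrite ltr_pdivlMr// mul1r.
pose f (j : idx) z := (if j.1 then be z else al z) ord0 j.2.
have := @surf_int_product_weight idx f (r / d%:R)
  (boxC R d * 3 ^+ (2 * d).-1) (enum {: idx}) p1 _ (enum_uniq _) setT 1
  (fun z => decay r (al z) * decay r (be z)) ler01 _ _.
rewrite mul1r -cardE card_prod card_bool card_ord; apply.
- by rewrite mulr_ge0 ?boxC_ge0 ?exprn_ge0.
- move=> b; have [c bc] := H b.
  apply: le_trans (hausdorff_box d0 c (ltr0n R 3)); apply: le_hausdorff.
  move=> z [Sz [_ bz]]; split => //; apply: bc => i; split.
    by apply: (bz (false, i)); rewrite mem_enum.
  by apply: (bz (true, i)); rewrite mem_enum.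
- move=> z _ _; split => //; rewrite mul1r big_enum/=.
  rewrite -(pair_bigA _ (fun b i => jbr1 (f (b, i) z) `^ (- (r / d%:R))))/= big_bool/=.
  have r0 : 0 <= r by apply: le_trans (ltW dr).
  by rewrite mulrC; apply: ler_pM; rewrite ?decay_ge0//; exact: decay_le_prod.
Qed.

(** The singular part of the density 1/|z|, near the vertex of the cone. *)
Definition truncated_inv (N : R) : R := if N <= 1 then N^-1 else 0.

Definition singC : R := 4 * boxC R d * 3 ^+ (2 * d).-1.

(** Dyadic shells: where |z| is about 2^-k the density is at most 2^(k+1) and the measure is
    O(2^(-k(2d-1))). As d >= 2, the exponent 2d-1 is at least 2, and the products are dominated by a
    geometric series. *)
Lemma surf_int_inv_norm : (1 < d)%N ->
  (surf_int_nonneg (fun z : Rdd => truncated_inv (enorm2 z)) <= singC%:E)%E.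
Proof.
move=> d1.
pose e (k : nat) : R := 2^-1 ^+ k.
have e0 k : 0 < e k by rewrite exprn_gt0.
pose gk (k : nat) (z : Rdd) := if enorm2 z <= e k then (e k.+1)^-1 else 0.
apply: le_trans (@surf_int_pieces _ _ d0 _ gk _) _.
  move=> z Sz; rewrite /truncated_inv; case: ifPn => [z1|]; last by rewrite ltxx.
  rewrite invr_gt0 => z0.
  have ex : exists n, e n < enorm2 z.
    exists (Num.truncn (enorm2 z)^-1).+1.
    rewrite /e exprVn invf_plt ?posrE ?exprn_gt0//.
    have zi0 : 0 <= (enorm2 z)^-1 by rewrite invr_ge0 ltW.
    have /andP[_ /lt_trans] := truncn_itv zi0; apply.
    by rewrite -natrX ltr_nat ltn_expl.
  (* The least [n] with [e n < enorm2 z] is not 0 because |z| <= 1; its predecessor [k] is the shell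
     of [z]. *)
  case: (ex_minnP ex) => -[|k] kz kmin.
    by move: kz; rewrite /e expr0 ltNge z1.
  exists k; rewrite /gk ifT; last first.
    by rewrite leNgt; apply/negP => /kmin; rewrite ltnn.
  by rewrite lef_pV2 ?posrE// ltW.
pose D := boxC R d * 3 ^+ (2 * d).-1.
have D0 : 0 <= D by rewrite mulr_ge0 ?boxC_ge0 ?exprn_ge0.
have gkB k : (surf_int_nonneg (gk k) <= (2 * D * 2^-1 ^+ k)%:E)%E.
  apply: (@le_trans _ _ ((e k.+1)^-1 * (boxC R d * (3 * e k) ^+ (2 * d).-1))%:E).
    (* Side [3 * e k] rather than [2 * e k], because the box is half-open and the ball closed. *)
    apply: (surf_int_cell d0 (E := box (fun=> - e k) (3 * e k))) => //.
    - by rewrite invr_ge0 ltW.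
    - by rewrite mulr_ge0 ?boxC_ge0 ?exprn_ge0 ?mulr_ge0// ltW.
    - move=> z _; rewrite /gk; case: ifPn => [zk _|]; last by rewrite ltxx.
      split => // j; have := le_trans (pcoord_le_enorm2 j z) zk.
      by move=> /ler_normlP[? ?]; have ek := e0 k; apply/andP; split; lra.
    - by apply: hausdorff_box => //; rewrite mulr_gt0.
  rewrite lee_fin (exprMn _ 3) [leLHS]mulrA /D.
  have L : e k ^+ (2 * d).-1 <= e k ^+ 2.
    apply: ler_wiXn2l => //; first exact: ltW.
      by rewrite exprn_ile1// invf_le1// ler1n.
    by case: d d1 => [//|[//|n]] _; rewrite mulnS.
  have -> : 2 * (boxC R d * 3 ^+ (2 * d).-1) * 2^-1 ^+ k =
    (e k.+1)^-1 * boxC R d * (3 ^+ (2 * d).-1 * e k ^+ 2).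
    have ek : e k != 0 by rewrite gt_eqF.
    rewrite {1}/e exprS -!/(e k); move: (3 ^+ _) => t; field.
    by rewrite ek.
  apply: ler_wpM2l; first by rewrite mulr_ge0 ?boxC_ge0// invr_ge0 ltW.
  by apply: ler_wpM2l => //; rewrite exprn_ge0.
apply: (@le_trans _ _ (\sum_(k <oo) (2 * D * 2^-1 ^+ k)%:E)%E).
  apply: lee_nneseries => k *; [exact: surf_int_ge0|exact: gkB].
apply: nneseries_le_bound => [k|n].
  by rewrite mulr_ge0 ?exprn_ge0// mulr_ge0.
rewrite -mulr_sumr (_ : singC = 2 * D * 2); last by rewrite /singC /D; ring.
apply: ler_wpM2l; first by rewrite mulr_ge0.
exact: geometric_half_sum_le.
Qed.

End Bounds.

(** * Pointwise inequalities for the Japanese bracket *)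

Section Japanese.
Variables (R : realType) (d : nat).
Notation Rd := ('rV[R]_d).
Implicit Types (a b s x : Rd).

Lemma jbr_sqr a : jbr a ^+ 2 = 1 + edot a a.
Proof. by rewrite /jbr enorm_sqr sqr_sqrtr// addr_ge0// edot_ge0. Qed.

Lemma edotD_le a b : edot (a + b) (a + b) <= 2 * edot a a + 2 * edot b b.
Proof.
rewrite !edotE !mulr_sumr -big_split/=; apply: ler_sum => i _; rewrite mxE.
have : 0 <= (a ord0 i - b ord0 i) ^+ 2 by exact: sqr_ge0.
by rewrite !expr2; lra.
Qed.

Lemma edotN a : edot (- a) (- a) = edot a a.
Proof. by rewrite !edotE; apply: eq_bigr => i _; rewrite mxE sqrrN. Qed.

Lemma jbrN a : jbr (- a) = jbr a.
Proof. by rewrite /jbr !enorm_sqr edotN. Qed.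

Lemma jbr_le_sqr a (c : R) : 0 <= c -> 1 + edot a a <= c ^+ 2 -> jbr a <= c.
Proof.
by move=> c0 ac; rewrite -ler_sqr ?nnegrE ?(ltW (jbr_gt0 a))// jbr_sqr.
Qed.

(* A form of Peetre's inequality that only needs the parallelogram law. *)
Lemma jbr_add_le_max a b : jbr (a + b) <= 2 * Num.max (jbr a) (jbr b).
Proof.
have ja := jbr_sqr a; have jb := jbr_sqr b; have := edotD_le a b.
have a1 := jbr_gt0 a; have b1 := jbr_gt0 b.
have [ab|/ltW ba] := leP (jbr a) (jbr b) => E; apply: jbr_le_sqr; try lra.
  have : jbr a ^+ 2 <= jbr b ^+ 2 by rewrite ler_sqr ?nnegrE// ltW.
  by rewrite exprMn; lra.
have : jbr b ^+ 2 <= jbr a ^+ 2 by rewrite ler_sqr ?nnegrE// ltW.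
by rewrite exprMn; lra.
Qed.

Lemma decay_le (r : R) a b : 0 <= r -> jbr a <= jbr b -> decay r b <= decay r a.
Proof. by move=> r0; apply: ler_powRN => //; exact: jbr_gt0. Qed.

Lemma decay_le_mul (r c : R) a b : 0 <= r -> 0 < c -> jbr b <= c * jbr a ->
  decay r a <= c `^ r * decay r b.
Proof.
move=> r0 c0 ab.
have -> : decay r a = c `^ r * (c * jbr a) `^ (- r).
  rewrite powRM ?(ltW c0) ?(ltW (jbr_gt0 a))// mulrA (powRN c).
  by rewrite mulfV ?mul1r// gt_eqF// powR_gt0.
by rewrite ler_wpM2l ?powR_ge0//; apply: ler_powRN => //; exact: jbr_gt0.
Qed.

Lemma decayD1 (r : R) a : decay (r + 1) a = decay r a * (jbr a)^-1.
Proof.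
rewrite /decay opprD powRD; last by rewrite (gt_eqF (jbr_gt0 a)) implybT.
by rewrite powR_inv1// ltW// jbr_gt0.
Qed.

Lemma decay_le1 (r : R) a : 0 <= r -> decay r a <= 1.
Proof.
move=> r0; have <- : 1 `^ (- r) = 1 :> R by rewrite powR1.
apply: ler_powRN => //; exact: jbr_ge1.
Qed.

(* Either [<x>] or [<x + s>] is comparable to [<s>] from below; in the second
   case one factor of [<x + s>^-r] is spent and the rest is moved to [<x>]. *)
Lemma decay_shift_div (r : R) x s : 1 <= r ->
  decay r (x + s) / jbr x <= 2 * (jbr s)^-1 * (decay r (x + s) + decay r x).
Proof.
move=> r1; have jx := jbr_gt0 x; have js := jbr_gt0 s; have jxs := jbr_gt0 (x + s).
have D1 := decay_ge0 r (x + s); have D2 := decay_ge0 r x.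
have js0 : 0 <= 2 * (jbr s)^-1 by rewrite mulr_ge0// invr_ge0 ltW.
have := jbr_add_le_max (x + s) (- x); rewrite jbrN addrAC subrr add0r.
have inv c : 0 < c -> jbr s <= 2 * c -> c^-1 <= 2 * (jbr s)^-1.
  by move=> c0 sc; rewrite ler_pdivlMr// mulrC ler_pdivrMr.
have [xs sx|xs /(inv _ jxs) sx] := leP (jbr (x + s)) (jbr x).
  apply: le_trans (ler_wpM2l D1 (inv _ jx sx)) _; rewrite [leLHS]mulrC.
  by apply: (ler_wpM2l js0); rewrite lerDl D2.
apply: (@le_trans _ _ (2 * (jbr s)^-1 * decay r x)); last first.
  by apply: (ler_wpM2l js0); rewrite lerDr D1.
have E1 : decay (r - 1) (x + s) <= decay (r - 1) x.
  by apply: decay_le; [rewrite subr_ge0|exact: ltW].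
have ji : 0 <= (jbr (x + s))^-1 by rewrite invr_ge0 ltW.
have jxi : 0 <= (jbr x)^-1 by rewrite invr_ge0 ltW.
have split1 (y : Rd) : decay r y = decay (r - 1) y * (jbr y)^-1 by rewrite -[in LHS](subrK 1 r) decayD1.
rewrite !split1 [leRHS]mulrCA [leRHS]mulrA.
exact: (ler_wpM2r jxi (ler_pM (decay_ge0 _ _) ji E1 sx)).
Qed.

End Japanese.

(** * The kinetic weight *)

Section KineticWeight.
Variables (R : realType) (d : nat).
Notation Rd := ('rV[R]_d).
Notation Rdd := ('rV[R]_d * 'rV[R]_d)%type.
Notation Sigma := (@Sigma_star R d).
Notation idx := (bool * 'I_d)%type.
Implicit Types (a b s x : Rd) (z : Rdd).

Lemma enorm2_sqr z : enorm2 z ^+ 2 = edot z.1 z.1 + edot z.2 z.2.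
Proof. by rewrite sqr_sqrtr// addr_ge0// edot_ge0. Qed.

Lemma enorm2_ge0 z : 0 <= enorm2 z.
Proof. exact: sqrtr_ge0. Qed.

Lemma enorm2_gt0 z : Sigma z -> 0 < enorm2 z.
Proof.
move=> [_ z0]; rewrite lt_neqAle enorm2_ge0 andbT; apply/eqP => e0.
apply: z0; apply: pcoord_eq0 => j; apply/eqP; rewrite -normr_le0.
by rewrite e0 pcoord_le_enorm2.
Qed.

Lemma jbr_le_2norm (N : R) x : 1 <= N -> edot x x <= N ^+ 2 -> jbr x <= 2 * N.
Proof.
move=> N1 xN; apply: jbr_le_sqr; first by rewrite mulr_ge0// (le_trans _ N1).
rewrite exprMn; move: xN (exprn_ege1 2 N1).
by move: (edot x x) (N ^+ 2) => u t; clear; lra.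
Qed.

(** The bracket of [x] is at most 2, hence at most twice that of [x + s]; the other factor 2 is that
    of [jbr_add_le_max]. *)
Lemma jbr_shift_le s x : edot x x <= 1 -> jbr s <= 4 * jbr (x + s).
Proof.
move=> x1; have := jbr_add_le_max (x + s) (- x); rewrite jbrN addrAC subrr add0r.
have : jbr x <= 2 by apply: jbr_le_sqr => //; move: (edot x x) x1 => u; lra.
have := jbr_ge1 (x + s); move: (jbr s) (jbr (x + s)) (jbr x) => j1 j2 j3.
by case: (leP j2 j3); lra.
Qed.

Lemma decay_le_inv_jbr (r : R) s x : 1 <= r -> edot x x <= 1 ->
  decay r (x + s) <= 4 * (jbr s)^-1.
Proof.
move=> r1 x1; apply: (@le_trans _ _ (jbr (x + s))^-1).
  rewrite (_ : r = (r - 1) + 1); last by rewrite subrK.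
  rewrite decayD1 ler_piMl ?invr_ge0 ?(ltW (jbr_gt0 _))//.
  by apply: decay_le1; rewrite subr_ge0.
rewrite ler_pdivlMr ?jbr_gt0// mulrC ler_pdivrMr ?jbr_gt0//.
exact: jbr_shift_le.
Qed.

(** [N] stands for |z|. For [N <= 1] the singular density is kept, and the weight at [x + s] alone
    yields 1/<s>. For [N > 1] one has 1/N <= 2/<x>, and [decay_shift_div] trades 1/<x> for 1/<s> at
    the price of a second pair with [x] unshifted. *)
Lemma decay_pair_div_norm (r N : R) x s b : 1 <= r -> 0 < N -> edot x x <= N ^+ 2 ->
  decay r (x + s) * decay r b / N <=
  (jbr s)^-1 * (4 * truncated_inv N +
    (4 * (decay r (x + s) * decay r b) + 4 * (decay r x * decay r b))).
Proof.
move=> r1 N0 xN; have r0 : 0 <= r := le_trans ler01 r1.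
have js := jbr_gt0 s; have jx := jbr_gt0 x.
have jsi : 0 <= (jbr s)^-1 by rewrite invr_ge0 ltW.
have D1 := decay_ge0 r (x + s); have D2 := decay_ge0 r x; have D3 := decay_ge0 r b.
have Ni : 0 <= N^-1 by rewrite invr_ge0 ltW.
rewrite /truncated_inv; case: ifPn => [N1|]; last first.
  rewrite -ltNge => N1; have xx : N^-1 <= 2 * (jbr x)^-1.
    rewrite ler_pdivlMr// mulrC ler_pdivrMr//.
    by apply: jbr_le_2norm => //; exact: ltW.
  have := ler_wpM2r D3 (decay_shift_div x s r1).
  have := ler_wpM2r D3 (ler_wpM2l D1 xx).
  move: (decay r (x + s)) (decay r x) (decay r b) (jbr s)^-1 (jbr x)^-1 N^-1.
  by move=> w1 w2 w3 j1 j2 n; clear; lra.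
have x1 : edot x x <= 1 by apply: le_trans xN _; rewrite exprn_ile1// ltW.
have := ler_wpM2r Ni (ler_pM D1 D3 (decay_le_inv_jbr s r1 x1) (decay_le1 b r0)).
have := mulr_ge0 jsi (mulr_ge0 D1 D3); have := mulr_ge0 jsi (mulr_ge0 D2 D3).
move: (decay r (x + s)) (decay r x) (decay r b) (jbr s)^-1 N^-1.
by move=> w1 w2 w3 j1 n; clear; lra.
Qed.

Variable d0 : (0 < d)%N.

(** Integrates [decay_pair_div_norm]. Each use of [surf_int_add2] doubles: 8 = 2*4 and 32 = 2*(2*4 +
    2*4). *)
Lemma decay_div_norm_int (r : R) (px : Rdd -> Rd) (be : Rdd -> Rd) s :
  (1 < d)%N -> d%:R < r ->
  (forall z, edot (px z) (px z) <= enorm2 z ^+ 2) ->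
  (surf_int_nonneg (fun z => decay r (px z + s) * decay r (be z))%R <= (pairC d r)%:E)%E ->
  (surf_int_nonneg (fun z => decay r (px z) * decay r (be z))%R <= (pairC d r)%:E)%E ->
  (surf_int_nonneg (fun z => decay r (px z + s) * decay r (be z) / enorm2 z)%R <=
    ((8 * singC R d + 32 * pairC d r) / jbr s)%:E)%E.
Proof.
move=> d1 dr pxz H1 H2.
have r1 : 1 <= r by apply: le_trans (ltW dr); rewrite ler1n.
have jsi : 0 < (jbr s)^-1 by rewrite invr_gt0 jbr_gt0.
have scale4 (f : Rdd -> R) (c : R) : (surf_int_nonneg f <= c%:E)%E ->
    (surf_int_nonneg (fun z => 4 * f z)%R <= (4 * c)%:E)%E.
  by move=> fc; rewrite surf_int_scale// EFinM lee_wpmul2l// lee_fin.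
have := surf_int_add2 d0 (fun z _ => lexx _) (scale4 _ _ H1) (scale4 _ _ H2).
move/(surf_int_add2 d0 (fun z _ => lexx _) (scale4 _ _ (surf_int_inv_norm R d0 d1))).
have jsiE : (0 <= (jbr s)^-1%:E)%E by rewrite lee_fin ltW.
move/(lee_wpmul2l jsiE) => H.
apply: le_trans (le_trans _ H) _; last first.
  by rewrite -EFinM lee_fin; move: (jbr s)^-1 => j; clear; lra.
rewrite -(surf_int_scale d0 _ jsi); apply: (surf_int_le d0) => z Sz.
exact: decay_pair_div_norm (enorm2_gt0 Sz) (pxz z).
Qed.

Definition kinetic_weight (r : R) s z : R :=
  let x := z.1 in let y := z.2 in
  decay r (x + s) * decay r (y + s) * decay r (x + y + s)
  + decay r (x + s) * decay r (y + s) * decay r s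
  + decay r (x + s) * decay r (x + y + s) * decay r s
  + decay r (y + s) * decay r (x + y + s) * decay r s.

(** Three of the products already contain [w4]; in [w1 * w2 * w3] the hypothesis exchanges [w1] or
    [w2] for [c * w4]. *)
Lemma triple_products_le (w1 w2 w3 w4 c : R) :
  0 <= w1 -> 0 <= w2 -> 0 <= w3 -> 0 <= w4 -> 0 <= c ->
  w1 <= c * w4 \/ w2 <= c * w4 ->
  w1 * w2 * w3 + w1 * w2 * w4 + w1 * w3 * w4 + w2 * w3 * w4 <=
  (c + 1) * w4 * (w1 * w2 + (w1 * w3 + w2 * w3)).
Proof.
move=> D1 D2 D3 D4 c0; have C0 := mulr_ge0 c0 D4.
have Q12 := mulr_ge0 C0 (mulr_ge0 D1 D2).
have Q13 := mulr_ge0 C0 (mulr_ge0 D1 D3).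
have Q23 := mulr_ge0 C0 (mulr_ge0 D2 D3).
by case=> [/(ler_wpM2r (mulr_ge0 D2 D3))|/(ler_wpM2r (mulr_ge0 D1 D3))]; lra.
Qed.

Lemma jbr_le_of_sum a b s : edot s s <= edot a a + edot b b -> jbr a <= jbr b ->
  jbr s <= 2 * jbr b.
Proof.
move=> sab ab; apply: jbr_le_sqr; first by rewrite mulr_ge0// ltW// jbr_gt0.
have : jbr a ^+ 2 <= jbr b ^+ 2 by rewrite ler_sqr ?nnegrE//; apply: ltW; exact: jbr_gt0.
rewrite exprMn !jbr_sqr; move: sab (edot_ge0 b).
by move: (edot s s) (edot a a) (edot b b) => u v w; clear; lra.
Qed.

(* On [x.y = 0] one has [|x+s|^2 + |y+s|^2 = |x+y+s|^2 + |s|^2], so [x + s] or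
   [y + s] is at least comparable to [s]. *)
Lemma kinetic_weight_le (r : R) s z : 0 <= r -> Sigma z ->
  kinetic_weight r s z <= (2 `^ r + 1) * decay r s *
    (decay r (z.1 + s) * decay r (z.2 + s) +
    (decay r (z.1 + s) * decay r (z.1 + z.2 + s) +
     decay r (z.2 + s) * decay r (z.1 + z.2 + s))).
Proof.
move=> r0 [xy _]; rewrite /kinetic_weight; move: z xy => [x y]/= xy.
have E : edot (x + s) (x + s) + edot (y + s) (y + s) =
    edot s s + edot (x + y + s) (x + y + s).
  rewrite -[LHS]addr0 -(mulr0 2) -xy /edot mulr_sumr -!big_split/=.
  by apply: eq_bigr => i _; rewrite !mxE; ring.
have D1 := decay_ge0 r (x + s); have D2 := decay_ge0 r (y + s).
have D3 := decay_ge0 r (x + y + s); have D4 := decay_ge0 r s.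
have es : edot s s <= edot (x + s) (x + s) + edot (y + s) (y + s).
  by rewrite E lerDl edot_ge0.
have : decay r (x + s) <= 2 `^ r * decay r s \/ decay r (y + s) <= 2 `^ r * decay r s.
  have [j12|/ltW j12] := leP (jbr (x + s)) (jbr (y + s)); [right|left].
    by apply: decay_le_mul => //; exact: jbr_le_of_sum j12.
  by apply: decay_le_mul => //; apply: jbr_le_of_sum j12; rewrite addrC.
by apply: triple_products_le => //; exact: powR_ge0.
Qed.

(** The factor 10 = 2 + 2*(2 + 2) comes from adding three pair integrals with two uses of
    [surf_int_add2]. *)
Definition kineticC (r : R) : R :=
  (2 `^ r + 1) * (10 * (8 * singC R d + 32 * pairC d r)).

Lemma box3 (z : Rdd) (c : idx -> R) :
  (forall i, c (false, i) <= z.1 ord0 i < c (false, i) + 3) ->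
  (forall i, c (true, i) <= z.2 ord0 i < c (true, i) + 3) -> box c 3 z.
Proof. by move=> H1 H2 [[] i]; rewrite /pcoord/=. Qed.

Lemma pair_xy_int (r : R) a b : d%:R < r ->
  (surf_int_nonneg (fun z : Rdd => decay r (z.1 + a) * decay r (z.2 + b))%R
     <= (pairC d r)%:E)%E.
Proof.
move=> dr; apply: surf_int_decay_pair => // c.
exists (fun j => if j.1 then c j - b ord0 j.2 else c j - a ord0 j.2).
move=> z H; apply: box3 => i /=; have := H i; rewrite !mxE.
  by move=> [/andP[? ?] _]; apply/andP; split; lra.
by move=> [_ /andP[? ?]]; apply/andP; split; lra.
Qed.

Lemma pair_xsum_int (r : R) a b : d%:R < r ->
  (surf_int_nonneg (fun z : Rdd => decay r (z.1 + a) * decay r (z.1 + z.2 + b))%R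
     <= (pairC d r)%:E)%E.
Proof.
move=> dr; apply: surf_int_decay_pair => // c.
(* As y = (x+y) - x, the lower end for [y] is that of [x + y] minus the upper end of [x]. *)
exists (fun j => if j.1 then c j - b ord0 j.2 - (c (false, j.2) + 1 - a ord0 j.2)
  else c j - a ord0 j.2).
move=> z H; apply: box3 => i /=; have := H i; rewrite !mxE;
  by move=> [/andP[? ?] /andP[? ?]]; apply/andP; split; lra.
Qed.

Lemma pair_ysum_int (r : R) a b : d%:R < r ->
  (surf_int_nonneg (fun z : Rdd => decay r (z.2 + a) * decay r (z.1 + z.2 + b))%R
     <= (pairC d r)%:E)%E.
Proof.
move=> dr; apply: surf_int_decay_pair => // c.
exists (fun j => if j.1 then c (false, j.2) - a ord0 j.2
  else c (true, j.2) - b ord0 j.2 - (c j + 1 - a ord0 j.2)).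
move=> z H; apply: box3 => i /=; have := H i; rewrite !mxE;
  by move=> [/andP[? ?] /andP[? ?]]; apply/andP; split; lra.
Qed.

(** [kinetic_weight_le] extracts <s>^-r and [decay_div_norm_int] the remaining <s>^-1. *)
Lemma kinetic_weight_int (r M : R) s (f : Rdd -> R) : (1 < d)%N -> d%:R < r -> 0 <= M ->
  (forall z, Sigma z -> f z <= M * kinetic_weight r s z) ->
  (muS_int_nonneg f <= (kineticC r * M * decay (r + 1) s)%:E)%E.
Proof.
move=> d1 dr M0 fM; rewrite /muS_int_nonneg.
have r0 : 0 <= r by apply: le_trans (ltW dr).
(* [surf_int_scale] needs a positive factor; for [M = 0] all superlevel sets on the cone are
   empty. *)
move: M0; rewrite le_eqVlt => /predU1P[M0|M0].
  rewrite -M0 mulr0 mul0r -(mul0r 0); apply: (surf_int_cell d0 (E := set0)) => //.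
    move=> z Sz; rewrite ltNge => /negP[]; have := fM z Sz; rewrite -M0 mul0r.
    by move=> f0; rewrite mulr_le0_ge0// invr_ge0 enorm2_ge0.
  by rewrite setI0 hausdorff0.
have x_le z : edot z.1 z.1 <= enorm2 z ^+ 2 by rewrite enorm2_sqr lerDl edot_ge0.
have y_le z : edot z.2 z.2 <= enorm2 z ^+ 2 by rewrite enorm2_sqr lerDr edot_ge0.
have H12 := @decay_div_norm_int r (fun z => z.1) (fun z => z.2 + s) s d1 dr x_le
  (pair_xy_int s s dr).
have H13 := @decay_div_norm_int r (fun z => z.1) (fun z => z.1 + z.2 + s) s d1 dr x_le
  (pair_xsum_int s s dr).
have H23 := @decay_div_norm_int r (fun z => z.2) (fun z => z.1 + z.2 + s) s d1 dr y_le
  (pair_ysum_int s s dr).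
(* The second pair of each [decay_div_norm_int] has its first argument unshifted, hence the shift
   0. *)
have := pair_xy_int 0 s dr; under eq_fun do rewrite addr0; move/H12 => {}H12.
have := pair_xsum_int 0 s dr; under eq_fun do rewrite addr0; move/H13 => {}H13.
have := pair_ysum_int 0 s dr; under eq_fun do rewrite addr0; move/H23 => {}H23.
have := surf_int_add2 d0 (fun z _ => lexx _) H12
  (surf_int_add2 d0 (fun z _ => lexx _) H13 H23).
have K0 : 0 < M * ((2 `^ r + 1) * decay r s).
  by rewrite !mulr_gt0// ?powR_gt0 ?jbr_gt0// addr_gt0 ?powR_gt0.
have K0E : (0 <= (M * ((2 `^ r + 1) * decay r s))%:E)%E by rewrite lee_fin ltW.
move/(lee_wpmul2l K0E) => H.
apply: le_trans (le_trans _ H) _; last first.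
  rewrite -EFinM lee_fin decayD1 /kineticC.
  by move: (jbr s)^-1 (decay r s) (2 `^ r) => j w c; clear; lra.
rewrite -(surf_int_scale d0 _ K0); apply: (surf_int_le d0) => z Sz.
have zi : 0 <= (enorm2 z)^-1 by rewrite invr_ge0 enorm2_ge0.
apply: le_trans (ler_wpM2r zi (fM z Sz)) _.
have := ler_wpM2r zi (ler_wpM2l (ltW M0) (kinetic_weight_le s r0 Sz)).
move/le_trans; apply; rewrite le_eqVlt; apply/orP; left; apply/eqP.
move: (decay r (z.1 + s)) (decay r (z.2 + s)) (decay r (z.1 + z.2 + s)) (decay r s).
by move: (enorm2 z)^-1 (2 `^ r) => n c w1 w2 w3 w4; clear; ring.
Qed.

End KineticWeight.

(** * Complex modulus and weighted uniform continuity *)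

Section ComplexModulus.
Variable R : realType.
Implicit Types z w : R[i].

Lemma cmodE z : normc z = Normc.normc z.
Proof. by case: z. Qed.

Lemma normc_ge0 z : 0 <= normc z.
Proof. exact: sqrtr_ge0. Qed.

Lemma cmodM z w : normc (z * w) = normc z * normc w.
Proof. by rewrite !cmodE Normc.normcM. Qed.

Lemma cmodD_le z w : normc (z + w) <= normc z + normc w.
Proof. by rewrite !cmodE; exact: (@le_normcD R z w). Qed.

Lemma cmodN z : normc (- z) = normc z.
Proof. by rewrite !cmodE; exact: (@normcN R z). Qed.

Lemma cmodB_le z w : normc (z - w) <= normc z + normc w.
Proof. by rewrite -(cmodN w); exact: cmodD_le. Qed.

Lemma normc_real (x : R) : normc (x%:C)%C = `|x|.
Proof. by rewrite /normc/= expr0n/= addr0 sqrtr_sqr. Qed.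

Lemma Re_le_normc z : `|complex.Re z| <= normc z.
Proof. by rewrite -sqrtr_sqr ler_wsqrtr// lerDl sqr_ge0. Qed.

Lemma Im_le_normc z : `|complex.Im z| <= normc z.
Proof. by rewrite -sqrtr_sqr ler_wsqrtr// lerDr sqr_ge0. Qed.

Lemma normc_le_ReIm z : normc z <= `|complex.Re z| + `|complex.Im z|.
Proof.
rewrite -[leRHS]ger0_norm ?addr_ge0// -sqrtr_sqr ler_wsqrtr// sqrrD.
by rewrite !real_normK ?num_real// -addrA lerD2l lerDr mulrn_wge0.
Qed.

Lemma cmodD4_le z1 z2 z3 z4 :
  normc (z1 + z2 + z3 + z4) <= normc z1 + normc z2 + normc z3 + normc z4.
Proof.
by do 3 (apply: le_trans (cmodD_le _ _) _; rewrite lerD2r).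
Qed.

Lemma normc_prod3_le z1 z2 z3 (M w1 w2 w3 : R) :
  0 <= M -> 0 <= w1 -> 0 <= w2 -> 0 <= w3 ->
  normc z1 <= M * w1 -> normc z2 <= M * w2 -> normc z3 <= M * w3 ->
  normc (z1 * z2 * z3) <= M ^+ 3 * (w1 * w2 * w3).
Proof.
move=> M0 w10 w20 w30 H1 H2 H3; rewrite !cmodM.
have -> : M ^+ 3 * (w1 * w2 * w3) = (M * w1) * (M * w2) * (M * w3) by ring.
by apply: ler_pM; rewrite ?mulr_ge0 ?normc_ge0//; apply: ler_pM; rewrite ?normc_ge0.
Qed.

(** Replace one factor at a time; each of the three terms costs one [eta] and two [M]. *)
Lemma normc_prod3B_le z1 z2 z3 u1 u2 u3 (eta M w1 w2 w3 : R) :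
  0 <= eta -> 0 <= M -> 0 <= w1 -> 0 <= w2 -> 0 <= w3 ->
  normc z1 <= M * w1 -> normc z2 <= M * w2 -> normc z3 <= M * w3 ->
  normc u1 <= M * w1 -> normc u2 <= M * w2 -> normc u3 <= M * w3 ->
  normc (z1 - u1) <= eta * w1 -> normc (z2 - u2) <= eta * w2 ->
  normc (z3 - u3) <= eta * w3 ->
  normc (z1 * z2 * z3 - u1 * u2 * u3) <= 3 * (eta * M ^+ 2) * (w1 * w2 * w3).
Proof.
move=> e0 M0 w10 w20 w30 Z1 Z2 Z3 U1 U2 U3 D1 D2 D3.
have -> : z1 * z2 * z3 - u1 * u2 * u3 =
  (z1 - u1) * z2 * z3 + u1 * (z2 - u2) * z3 + u1 * u2 * (z3 - u3) by ring.
have P a b c (A B C : R) : normc a <= A -> normc b <= B -> normc c <= C ->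
    normc (a * b * c) <= A * B * C.
  move=> aA bB cC; rewrite !cmodM.
  by apply: ler_pM; rewrite ?mulr_ge0 ?normc_ge0//; apply: ler_pM; rewrite ?normc_ge0.
have := P _ _ _ _ _ _ D1 Z2 Z3; have := P _ _ _ _ _ _ U1 D2 Z3.
have := P _ _ _ _ _ _ U1 U2 D3.
have := cmodD_le ((z1 - u1) * z2 * z3 + u1 * (z2 - u2) * z3) (u1 * u2 * (z3 - u3)).
have := cmodD_le ((z1 - u1) * z2 * z3) (u1 * (z2 - u2) * z3).
move: (normc _) (normc _) (normc _) (normc _) (normc _) => n1 n2 n3 n4 n5.
by rewrite !expr2; clear; lra.
Qed.

Lemma posp_le_norm (a : R) : posp a <= `|a|.
Proof. by rewrite ge_max ler_norm normr_ge0. Qed.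

Lemma pospB_le (a b : R) : `|posp a - posp b| <= `|a - b|.
Proof.
rewrite /posp; have := ler_norm (a - b); have := ler_norm (- (a - b)); rewrite normrN.
move: `|a - b| => n H1 H2; rewrite ler_norml.
by case: (leP a 0) => a0; case: (leP b 0) => b0; apply/andP; split; lra.
Qed.

Lemma negpE (a : R) : negp a = posp (- a).
Proof. by []. Qed.

End ComplexModulus.

Section Continuity.
Variables (R : realType) (d : nat) (d0 : (0 < d)%N).
Notation Rd := ('rV[R]_d).
Implicit Types (a b s : Rd) (v : Rd -> R[i]).

Lemma enorm_lt (a : Rd) (e : R) : 0 < e -> (enorm a < e) = (edot a a < e ^+ 2).
Proof.
by move=> e0; rewrite -enorm_sqr ltr_pXn2r// nnegrE ?enorm_ge0// ltW.
Qed.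

(** Links the sup-norm topology of row vectors to Euclidean balls. *)
Lemma enorm_small (e : R) : 0 < e -> exists2 h, 0 < h &
  forall a : Rd, (forall i, `|a ord0 i| < h) -> enorm a < e.
Proof.
move=> e0; have dR : 0 < d%:R :> R by rewrite ltr0n.
have d1 : 1 <= d%:R :> R by rewrite ler1n.
exists (e / (2 * d%:R)); first by rewrite divr_gt0// mulr_gt0.
move=> a ah; rewrite enorm_lt// edotE.
set h := e / (2 * d%:R) in ah.
have hE : e = 2 * d%:R * h by rewrite /h; field; rewrite gt_eqF.
have h0 : 0 < h by rewrite /h divr_gt0// mulr_gt0.
clearbody h; apply: (@le_lt_trans _ _ (\sum_(i < d) h ^+ 2)).
  apply: ler_sum => i _; rewrite -(real_normK (num_real _)).
  by rewrite lerXn2r ?nnegrE// ltW.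
rewrite sumr_const card_ord -mulr_natl hE !exprMn.
have h2 : 0 < h ^+ 2 by rewrite exprn_gt0.
rewrite ltr_pM2r//; have : d%:R <= d%:R ^+ 2 :> R by rewrite ler_eXnr.
by move: d1; rewrite !expr2; move: (d%:R : R) => n; clear; lra.
Qed.

(** Heine-Cantor on the compact cube of half-side [rho], which contains all [a] with [jbr a <= rho];
    the point [b] may lie outside it. *)
Lemma uniform_continuous_ball v (rho eta : R) : ccontinuous v -> 0 < eta ->
  exists2 del, 0 < del & forall a b, jbr a <= rho -> enorm (b - a) < del ->
    normc (v b - v a) < eta.
Proof.
move=> cv eta0.
pose A := [set a : Rd | forall i, (`[- rho, rho]%classic : set R) (a ord0 i)].
have cA : compact A.
  by apply: (@rV_compact _ _ (fun=> `[- rho, rho]%classic)) => _; exact: segment_compact.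
pose P (del : R) (a : Rd) := forall b, enorm (b - a) < del -> normc (v b - v a) < eta.
have nA : \forall del \near 0^'+, A `<=` P del.
  apply: ((compact_near_coveringP A).1 cA R (0^'+) P _ _) => x Ax.
  have eta2 : 0 < eta / 2 by rewrite divr_gt0.
  have [del del0 cdel] := cv x _ eta2.
  have del2 : 0 < del / 2 by rewrite divr_gt0.
  exists ([set x' | enorm (x' - x) < del / 2], [set i | i < del / 2]).
    split; last exact: nbhs_right_lt.
    have [h h0 hh] := enorm_small del2.
    apply/nbhs_ballP; exists h => // y xy; apply: hh => i.
    by have := xy.2 ord0 i; rewrite !mxE /ball/= distrC.
  move=> [x' i] [/= x'x idel] b bx'.
  (* With both distances below del/2, [edotD_le] gives 2(del/2)^2 + 2(del/2)^2 = del^2. *)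
  have bx : normc (v b - v x) < eta / 2.
    apply: cdel; rewrite enorm_lt//.
    have : b - x = (b - x') + (x' - x) by rewrite addrA subrK.
    move=> ->; apply: le_lt_trans (edotD_le _ _) _.
    have := lt_trans bx' idel; rewrite enorm_lt//; rewrite enorm_lt// in x'x.
    rewrite exprMn in x'x *.
    by move: x'x; move: (edot _ _) (edot _ _) => u w; rewrite expr2; clear; lra.
  have x'x' : normc (v x' - v x) < eta / 2.
    by apply: cdel; apply: lt_trans x'x _; rewrite gtr_pMr// invf_lt1// ltr1n.
  have := cmodB_le (v b - v x) (v x' - v x).
  rewrite opprB addrA subrK => H; apply: le_lt_trans H _.
  by rewrite [ltRHS]splitr ltrD.
have nA0 : \forall del \near (0 : R)^'+, A `<=` P del /\ 0 < del.
  by apply: filterI; [exact: nA|exact: nbhs_right_gt].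
have [del [delP del0]] := @filter_ex _ _ (@at_right_proper_filter R 0) _ nA0.
exists del => // a b ja; apply: delP => i /=.
have := le_trans (jbr1_le_jbr a i) ja => ai.
rewrite in_itv/= -ler_norml; apply: le_trans ai.
by rewrite -sqrtr_sqr ler_wsqrtr// lerDr.
Qed.

Lemma decay_mono (r r' : R) a : r' <= r -> decay r a <= decay r' a.
Proof. by move=> rr; apply: ler_powR; rewrite ?jbr_ge1 ?lerN2. Qed.

Lemma decay_shift_near (r : R) a b : 0 <= r -> enorm (b - a) < 1 ->
  decay r b <= 4 `^ r * decay r a.
Proof.
move=> r0 ab; apply: decay_le_mul => //.
rewrite -(subrK a b) in ab *; rewrite addrK in ab.
apply: jbr_shift_le; move: ab.
by rewrite enorm_lt// expr1n => /ltW.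
Qed.

(** For [jbr a <= rho], uniform continuity on a compact set applies. Beyond, both values are
    O(<a>^-r), and the spare factor <a>^-(r-r') is already small. *)
Lemma uniform_continuous_decay v (r r' M eta : R) : ccontinuous v ->
  0 <= r' -> r' < r -> 0 <= M -> (forall a, normc (v a) <= M * decay r a) -> 0 < eta ->
  exists2 del, 0 < del & forall a b, enorm (b - a) < del ->
    normc (v b - v a) <= eta * decay r' a.
Proof.
move=> cv r'0 r'r M0 vM eta0; have r0 : 0 <= r by rewrite (le_trans r'0)// ltW.
pose M' := M * (4 `^ r + 1) + 1.
have M'0 : 0 < M'.
  by rewrite ltr_wpDl// mulr_ge0// addr_ge0// powR_ge0.
have q0 : 0 < r - r' by rewrite subr_gt0.
(* Chosen so that rho^-(r-r') = eta/M'. *)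
pose rho := (M' / eta) `^ (r - r')^-1.
have rho0 : 0 < rho by rewrite powR_gt0// divr_gt0.
have rhoE : rho `^ (- (r - r')) = eta / M'.
  rewrite powRN /rho -powRrM mulVf ?gt_eqF// powRr1 ?invf_div//.
  by rewrite divr_ge0// ltW.
(* A lower bound for [eta * decay r' a] over all [a] with [jbr a <= rho]. *)
have eta'0 : 0 < eta * rho `^ (- r') by rewrite mulr_gt0// powR_gt0.
have [del del0 Hdel] := uniform_continuous_ball rho cv eta'0.
exists (Num.min del 1); first by rewrite lt_min del0 ltr01.
move=> a b; rewrite lt_min => /andP[abdel ab1].
have [arho|/ltW rhoa] := leP (jbr a) rho.
  apply: le_trans (ltW (Hdel _ _ arho abdel)) _; rewrite ler_wpM2l ?(ltW eta0)//.
  by apply: ler_powRN => //; exact: jbr_gt0.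
apply: le_trans (cmodB_le _ _) _.
have -> : decay r' a = decay r a * jbr a `^ (r - r').
  rewrite /decay -powRD; first by congr powR; ring.
  by rewrite (gt_eqF (jbr_gt0 a)) implybT.
have D0 := decay_ge0 r a.
have : M' / eta <= jbr a `^ (r - r').
  have -> : M' / eta = rho `^ (r - r') by rewrite -[r - r']opprK powRN rhoE invf_div.
  by apply: ge0_ler_powR; rewrite ?nnegrE// ltW// jbr_gt0.
rewrite ler_pdivrMr// mulrC => /(ler_wpM2l D0) H1.
have H2 := ler_wpM2l M0 (decay_shift_near r0 ab1).
have := vM a; have := vM b; move: H1 H2 D0; rewrite /M'.
move: (jbr a `^ _) (decay r a) (decay r b) (4 `^ r) (normc (v a)) (normc (v b)).
by move=> j w1 w2 c n1 n2; clear; lra.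
Qed.

End Continuity.

(** * The kinetic integral *)

Lemma normrB4_le (R : realDomainType) (a b a' b' c : R) :
  `|a - a'| <= c -> `|b - b'| <= c -> `|(a - b) - (a' - b')| <= 2 * c.
Proof.
by rewrite !ler_norml => /andP[? ?] /andP[? ?]; apply/andP; split; lra.
Qed.

Section KineticIntegral.
Variables (R : realType) (d : nat) (d1 : (1 < d)%N).
Notation Rd := ('rV[R]_d).
Notation Rdd := ('rV[R]_d * 'rV[R]_d)%type.
Implicit Types (a b s t : Rd) (v : Rd -> R[i]) (z : Rdd).

Let d0 : (0 < d)%N. Proof. exact: ltnW d1. Qed.

Lemma K_integrand_le v (r M : R) s z : 0 <= M -> (forall a, normc (v a) <= M * decay r a) ->
  normc (K_integrand v s z) <= M ^+ 3 * kinetic_weight r s z.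
Proof.
move=> M0 vM; rewrite /K_integrand /kinetic_weight/=.
have P a b c : normc (v a * v b * v c) <= M ^+ 3 * (decay r a * decay r b * decay r c).
  by apply: normc_prod3_le => //; exact: decay_ge0.
apply: le_trans (cmodD4_le _ _ _ _) _.
rewrite !cmodN !mulrDr; do 3 (apply: lerD; last exact: P); exact: P.
Qed.

(** All four arguments of [v] move by the same vector [t - s], so one modulus of continuity serves
    them all, with weights taken at the points belonging to [s]. *)
Lemma K_integrandB_le v (r M eta : R) s t z : 0 <= M -> 0 <= eta ->
  (forall a b, b - a = t - s -> [/\ normc (v b) <= M * decay r a,
    normc (v a) <= M * decay r a & normc (v b - v a) <= eta * decay r a]) ->
  normc (K_integrand v t z - K_integrand v s z) <=
  3 * (eta * M ^+ 2) * kinetic_weight r s z.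
Proof.
move=> M0 eta0 H.
have P a a' b b' c c' : a' - a = t - s -> b' - b = t - s -> c' - c = t - s ->
    normc (v a' * v b' * v c' - v a * v b * v c) <=
    3 * (eta * M ^+ 2) * (decay r a * decay r b * decay r c).
  by move=> /H[? ? ?] /H[? ? ?] /H[? ? ?]; apply: normc_prod3B_le; rewrite ?decay_ge0.
have sh a : (a + t) - (a + s) = t - s by rewrite opprD addrACA subrr add0r.
rewrite /K_integrand /kinetic_weight/=; move: z.1 z.2 => x y.
have := P _ _ _ _ _ _ (sh x) (sh y) (sh (x + y)).
have := P _ _ _ _ _ _ (sh x) (sh y) (erefl (t - s)).
have := P _ _ _ _ _ _ (sh x) (sh (x + y)) (erefl (t - s)).
have := P _ _ _ _ _ _ (sh y) (sh (x + y)) (erefl (t - s)).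
move: (v (x + t)) (v (y + t)) (v (x + y + t)) (v t) => b1 b2 b3 b4.
move: (v (x + s)) (v (y + s)) (v (x + y + s)) (v s) => a1 a2 a3 a4.
have -> : b1 * b2 * b3 + b1 * b2 * b4 - b1 * b3 * b4 - b2 * b3 * b4
    - (a1 * a2 * a3 + a1 * a2 * a4 - a1 * a3 * a4 - a2 * a3 * a4) =
    (b1 * b2 * b3 - a1 * a2 * a3) + (b1 * b2 * b4 - a1 * a2 * a4)
    + - (b1 * b3 * b4 - a1 * a3 * a4) + - (b2 * b3 * b4 - a2 * a3 * a4) by ring.
move=> H4 H3 H2 H1; apply: le_trans (cmodD4_le _ _ _ _) _.
rewrite !cmodN !mulrDr; exact: lerD (lerD (lerD H1 H2) H3) H4.
Qed.

Lemma decay_le_self (r : R) s : 0 <= r -> decay (r + 1) s <= 1.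
Proof. by move=> r0; apply: decay_le1; rewrite addr_ge0. Qed.

Lemma kineticC_ge0 (r : R) : d%:R < r -> 0 <= kineticC d r.
Proof.
move=> dr; have dR : 0 < d%:R :> R by rewrite ltr0n.
have p1 : 1 < r / d%:R by rewrite ltr_pdivlMr// mul1r.
have B0 : 0 <= boxC R d by exact: boxC_ge0.
have T0 : 0 <= 3 ^+ (2 * d).-1 :> R by rewrite exprn_ge0.
rewrite /kineticC /singC /pairC mulr_ge0 ?addr_ge0 ?powR_ge0// mulr_ge0// addr_ge0//.
  by apply: mulr_ge0 => //; apply: mulr_ge0 => //; exact: mulr_ge0.
apply: mulr_ge0 => //; apply: mulr_ge0; first exact: mulr_ge0.
by apply: exprn_ge0; exact: weightC_ge0.
Qed.

Lemma muS_int_nonneg_fineK_le (f : Rdd -> R) (B : R) : 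
  (muS_int_nonneg f <= B%:E)%E -> 0 <= fine (muS_int_nonneg f) <= B.
Proof.
rewrite /muS_int_nonneg => H; have := surf_int_ge0 d0 (fun z => f z / enorm2 z).
move: H; case: surf_int_nonneg => [x||]//=.
by rewrite !lee_fin => -> ->.
Qed.

Section FixedFunction.
Variables (v : Rd -> R[i]) (r M : R).
Hypotheses (dr : d%:R < r) (M0 : 0 <= M) (vM : forall a, normc (v a) <= M * decay r a).

Let r0 : 0 <= r. Proof. by apply: le_trans (ltW dr). Qed.

Lemma muS_int_nonneg_le (f : Rdd -> R) s :
  (forall z, f z <= normc (K_integrand v s z)) ->
  (muS_int_nonneg f <= (kineticC d r * M ^+ 3 * decay (r + 1) s)%:E)%E.
Proof.
move=> fF; apply: (kinetic_weight_int d0 d1 dr); first by rewrite exprn_ge0.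
by move=> z _; apply: le_trans (fF z) _; exact: K_integrand_le.
Qed.

Lemma parts_le_normc (w : R[i]) : [/\ posp (complex.Re w) <= normc w,
  negp (complex.Re w) <= normc w, posp (complex.Im w) <= normc w &
  negp (complex.Im w) <= normc w].
Proof.
split; rewrite ?negpE; apply: le_trans (posp_le_norm _) _; rewrite ?normrN;
  by [exact: Re_le_normc|exact: Im_le_normc].
Qed.

Lemma parts_lipschitz (w w' : R[i]) : [/\
  `|posp (complex.Re w) - posp (complex.Re w')| <= normc (w - w'),
  `|negp (complex.Re w) - negp (complex.Re w')| <= normc (w - w'),
  `|posp (complex.Im w) - posp (complex.Im w')| <= normc (w - w') &
  `|negp (complex.Im w) - negp (complex.Im w')| <= normc (w - w')].
Proof.
have reB : `|complex.Re w - complex.Re w'| <= normc (w - w').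
  by rewrite -raddfB; exact: Re_le_normc.
have imB : `|complex.Im w - complex.Im w'| <= normc (w - w').
  by rewrite -raddfB; exact: Im_le_normc.
by split; rewrite ?negpE; apply: le_trans (pospB_le _ _) _; rewrite // -opprD normrN.
Qed.

Lemma normc_KE s : normc (K v s) = 2 * pi * normc (muS_int (K_integrand v s)).
Proof.
by rewrite /K cmodM normc_real ger0_norm// mulr_ge0// pi_ge0.
Qed.

(** The real and imaginary parts are differences of two numbers in [0, B], so the modulus of the
    integral is at most 2B; the prefactor 2 pi makes 4 pi. *)
Lemma normc_K_le s :
  normc (K v s) <= 4 * pi * kineticC d r * M ^+ 3 * decay (r + 1) s.
Proof.
have diff (a b c : R) : 0 <= a <= c -> 0 <= b <= c -> `|a - b| <= c.
  by move=> /andP[? ?] /andP[? ?]; rewrite ler_norml; apply/andP; split; lra.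
rewrite normc_KE; set B := kineticC d r * M ^+ 3 * decay (r + 1) s.
have part f : (forall z, f z <= normc (K_integrand v s z)) ->
    0 <= fine (muS_int_nonneg f) <= B.
  by move=> fF; apply: muS_int_nonneg_fineK_le; exact: muS_int_nonneg_le.
have H : normc (muS_int (K_integrand v s)) <= 2 * B.
  apply: le_trans (normc_le_ReIm _) _; rewrite /muS_int/=.
  rewrite mulr_natl mulr2n; apply: lerD; apply: diff; apply: part => z;
    by case: (parts_le_normc (K_integrand v s z)).
have /ler_wpM2l : 0 <= 2 * pi :> R by rewrite mulr_ge0// pi_ge0.
move=> /(_ _ _ H)/le_trans; apply; rewrite /B.
by rewrite le_eqVlt; apply/orP; left; apply/eqP; ring.
Qed.

Lemma K_integrable s : muS_integrable (K_integrand v s).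
Proof. by apply: le_lt_trans (ltry _); exact: muS_int_nonneg_le. Qed.

Lemma K_continuous : ccontinuous v -> ccontinuous (K v).
Proof.
move=> cv.
(* r' > d keeps the kinetic integrals finite; r' < r leaves room for [uniform_continuous_decay]. *)
pose r' := (d%:R + r) / 2; have [dr' r'r] := midf_lt dr; rewrite -/r' in dr' r'r.
have r'0 : 0 <= r' by apply: le_trans (ltW dr').
(* [Q * decay r' a] dominates both [v a] and [v b] once |b-a| < 1, by [decay_shift_near]. *)
pose Q := M * 4 `^ r.
have Q0 : 0 <= Q by rewrite mulr_ge0// powR_ge0.
have c1 : 1 <= 4 `^ r :> R.
  have := @ler_powR R 4 _ 0 r r0; rewrite powRr0; apply.
  by rewrite ler1n.
pose L := kineticC d r' * (3 * Q ^+ 2).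
have L0 : 0 <= L by rewrite mulr_ge0 ?kineticC_ge0// mulr_ge0// exprn_ge0.
pose B := kineticC d r * M ^+ 3.
have B0 : 0 <= B by rewrite mulr_ge0 ?kineticC_ge0// exprn_ge0.
move=> s e e0.
have pi0 : 0 < pi :> R by exact: pi_gt0.
(* The prefactor 2 pi times the four parts, each contributing [eps * (B + 2)]. *)
pose D := 8 * pi * (B + 2).
have D0 : 0 < D by rewrite /D mulr_gt0// ?mulr_gt0// ltr_wpDl.
pose eps := Num.min 1 (e / (2 * D)).
have eps0 : 0 < eps by rewrite lt_min ltr01 divr_gt0// mulr_gt0.
have eps1 : eps <= 1 by rewrite ge_min lexx.
have epse : eps * D < e.
  apply: (@le_lt_trans _ _ (e / (2 * D) * D)).
    by apply: ler_wpM2r; [exact: ltW|rewrite ge_min lexx orbT].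
  have -> : e / (2 * D) * D = e / 2 by field; rewrite gt_eqF.
  lra.
(* Makes the integral of the majorant [h] at most [eps ^+ 2], as [surf_int_fine_diff] requires. *)
pose eta : R := eps ^+ 2 / (L + 1).
have L10 : 0 < L + 1 by rewrite ltr_wpDl.
have eta0 : 0 < eta by rewrite divr_gt0// exprn_gt0.
have etaL : L * eta <= eps ^+ 2.
  rewrite /eta mulrA ler_pdivrMr// mulrC ler_wpM2l ?sqr_ge0//; lra.
have [del del0 Hdel] := uniform_continuous_decay d0 cv r'0 r'r M0 vM eta0.
exists (Num.min del 1); first by rewrite lt_min del0 ltr01.
move=> t; rewrite lt_min => /andP[tsd ts1].
have F z : normc (K_integrand v t z - K_integrand v s z) <=
    3 * (eta * Q ^+ 2) * kinetic_weight r' s z.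
  apply: K_integrandB_le; [exact: Q0|exact: ltW|move=> a b ab].
  split; last by apply: Hdel; rewrite ab.
    apply: le_trans (vM b) _; rewrite /Q -mulrA; apply: ler_wpM2l => //.
    apply: le_trans (_ : 4 `^ r * decay r a <= _).
      by apply: (decay_shift_near r0); rewrite ab.
    by apply: ler_wpM2l; [exact: powR_ge0|exact: decay_mono (ltW r'r)].
  apply: le_trans (vM a) _; rewrite /Q -mulrA; apply: ler_wpM2l => //.
  apply: le_trans (decay_mono a (ltW r'r)) _.
  by rewrite ler_peMl// decay_ge0.
pose h z : R := 3 * (eta * Q ^+ 2) * kinetic_weight r' s z.
have hI : (muS_int_nonneg h <= (eps ^+ 2)%:E)%E.
  apply: le_trans (_ : _ <= (kineticC d r' * (3 * (eta * Q ^+ 2)) * decay (r' + 1) s)%:E)%E _.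
    apply: (kinetic_weight_int d0 d1 dr') => //.
    by rewrite mulr_ge0// mulr_ge0 ?sqr_ge0// ltW.
  rewrite lee_fin; apply: le_trans etaL.
  have -> : L * eta = kineticC d r' * (3 * (eta * Q ^+ 2)) by rewrite /L; ring.
  rewrite ler_piMr ?decay_le_self// mulr_ge0 ?kineticC_ge0//.
  by rewrite mulr_ge0// mulr_ge0 ?sqr_ge0// ltW.
have diff (p : R[i] -> R) : (forall w, p w <= normc w) ->
    (forall w w', `|p w - p w'| <= normc (w - w')) ->
    `|fine (muS_int_nonneg (fun z => p (K_integrand v t z))) -
      fine (muS_int_nonneg (fun z => p (K_integrand v s z)))| <= eps * (B + 2).
  move=> pn pB.
  (* Bounding the decay factor by 1 lets the same [B] serve at [t] and at [s]. *)
  have bound u : (muS_int_nonneg (fun z => p (K_integrand v u z)) <= B%:E)%E.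
    apply: le_trans (muS_int_nonneg_le (s := u) (fun z => pn _)) _.
    by rewrite lee_fin ler_piMr// decay_le_self.
  apply: (@le_trans _ _ (eps * (B + 1 + eps))); last first.
    by rewrite ler_wpM2l ?(ltW eps0)//; lra.
  apply: (surf_int_fine_diff d0 eps0 _ (bound t) (bound s) hI) => z Sz.
  have ni : 0 <= (enorm2 z)^-1 by rewrite invr_ge0 enorm2_ge0.
  rewrite -mulrBl normrM (ger0_norm ni); apply: (ler_wpM2r ni).
  exact: le_trans (pB _ _) (F z).
have d1' := diff (fun w => posp (complex.Re w))
  (fun w => let: And4 a _ _ _ := parts_le_normc w in a)
  (fun w w' => let: And4 a _ _ _ := parts_lipschitz w w' in a).
have d2' := diff (fun w => negp (complex.Re w))
  (fun w => let: And4 _ a _ _ := parts_le_normc w in a)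
  (fun w w' => let: And4 _ a _ _ := parts_lipschitz w w' in a).
have d3' := diff (fun w => posp (complex.Im w))
  (fun w => let: And4 _ _ a _ := parts_le_normc w in a)
  (fun w w' => let: And4 _ _ a _ := parts_lipschitz w w' in a).
have d4' := diff (fun w => negp (complex.Im w))
  (fun w => let: And4 _ _ _ a := parts_le_normc w in a)
  (fun w w' => let: And4 _ _ _ a := parts_lipschitz w w' in a).
have -> : K v t - K v s = ((2 * pi)%:C)%C *
    (muS_int (K_integrand v t) - muS_int (K_integrand v s)) by rewrite /K mulrBr.
rewrite cmodM normc_real ger0_norm; last by rewrite mulr_ge0// ltW.
apply: le_lt_trans epse.
have -> : eps * D = 2 * pi * (4 * (eps * (B + 2))) by rewrite /D; ring.
apply: ler_wpM2l; first by rewrite mulr_ge0// ltW.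
apply: le_trans (normc_le_ReIm _) _; rewrite /muS_int/=.
rewrite (_ : 4 = 2 + 2 :> R); last by rewrite -natrD.
by rewrite mulrDl; exact: lerD (normrB4_le d1' d2') (normrB4_le d3' d4').
Qed.

End FixedFunction.
End KineticIntegral.

Theorem theorem4p1 (R : realType) (d : nat) (r : R) :
  (2 <= d)%N -> d%:R < r ->
  exists Cr : R, forall v : 'rV[R]_d -> R[i],
    in_Cr r v ->
    (forall s, muS_integrable (K_integrand v s)) /\
    in_Cr (r + 1) (K v) /\
    wnorm (r + 1) (K v) <= Cr * wnorm r v ^+ 3.
Proof.
move=> d1 dr; exists (4 * pi * kineticC d r) => v [cv [M0 vM0]].
have ub : has_ubound [set normc (v s) * powR (jbr s) r | s in [set: 'rV[R]_d]].
  by exists M0 => _ [s _ <-].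
(* The norm itself serves as the constant [M] of the preceding section, which turns [M ^+ 3] into
   the cubic bound. *)
have vM a : normc (v a) <= wnorm r v * decay r a.
  rewrite /decay powRN ler_pdivlMr ?powR_gt0 ?jbr_gt0//.
  by apply: (ub_le_sup ub); exists a.
have M_ge0 : 0 <= wnorm r v.
  have : 0 <= normc (v 0) * powR (jbr (0 : 'rV[R]_d)) r.
    by rewrite mulr_ge0 ?normc_ge0 ?powR_ge0.
  by move/le_trans; apply; apply: (ub_le_sup ub); exists 0.
have KM s : normc (K v s) * powR (jbr s) (r + 1) <=
    4 * pi * kineticC d r * wnorm r v ^+ 3.
  rewrite -ler_pdivlMr ?powR_gt0 ?jbr_gt0// -powRN.
  exact: (normc_K_le d1 dr M_ge0 vM).
split; first by move=> s; exact: (K_integrable d1 dr M_ge0 vM).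
split; first split.
- exact: (K_continuous d1 dr M_ge0 vM cv).
- by exists (4 * pi * kineticC d r * wnorm r v ^+ 3).
apply: ge_sup; first by exists (normc (K v 0) * powR (jbr (0 : 'rV[R]_d)) (r + 1)), 0.
by move=> _ [s _ <-].
Qed.
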